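(* Assume $p$ odd, $p\nmid n$, $\ell\ge2$. A regular representation $\delta$ of ${\rm SL}_n(\mathfrak o_\ell)$ admits a $\theta$-Whittaker model for every non-degenerate character $\theta$ of $\mathbf U(\mathfrak o_\ell)$ if and only if $\delta$ is special-regular.
   Context: $\mathfrak o$: ring of integers of a non-archimedean local field, uniformizer $\varpi$, residue field $\mathbb F_q$ of characteristic $p$; $\mathfrak o_r=\mathfrak o/\varpi^r\mathfrak o$. $\mathbf U(\mathfrak o_\ell)$: upper unitriangular matrices in ${\rm SL}_n(\mathfrak o_\ell)$. A primitive character of $(\mathfrak o_\ell,+)$ is one nontrivial on $\varpi^{\ell-1}\mathfrak o_\ell$; a non-degenerate character of $\mathbf U(\mathfrak o_\ell)$ is $\theta((u_{ij}))=\prod_{i=1}^{n-1}\varphi_i(u_{i,i+1})$ with all $\varphi_i$ primitive; $\delta$ admits a $\theta$-Whittaker model if $\mathrm{Hom}(\delta,\mathrm{Ind}_{\mathbf U(\mathfrak o_\ell)}^{{\rm SL}_n(\mathfrak o_\ell)}\theta)\ne0$. For $\mathbf G\in\{{\rm GL}_n,{\rm SL}_n\}$ with $\mathfrak g=M_n$ or $\mathfrak{sl}_n$: $K_\ell^{\ell-1}=\ker(\mathbf G(\mathfrak o_\ell)\to\mathbf G(\mathfrak o_{\ell-1}))$, and for a fixed primitive $\varphi$ each $x\in\mathfrak g(\mathbb F_q)$ gives a character $\varphi_x(I+\varpi^{\ell-1}y)=\varphi(\varpi^{\ell-1}\mathrm{tr}(\hat xy))$; $x$ is regular if its characteristic polynomial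 equals its minimal polynomial; an irreducible representation is regular if its restriction to $K_\ell^{\ell-1}$ contains $\varphi_x$ with $x$ regular. A regular representation $\delta$ of ${\rm SL}_n(\mathfrak o_\ell)$ is special-regular if $\delta\cong\mathrm{Res}^{{\rm GL}_n(\mathfrak o_\ell)}_{{\rm SL}_n(\mathfrak o_\ell)}\rho$ for some regular representation $\rho$ of ${\rm GL}_n(\mathfrak o_\ell)$. *)

(* Defs.v *)
From HB Require Import structures.
From mathcomp Require Import all_boot all_order all_algebra all_fingroup all_solvable all_field all_character.
Set Implicit Arguments.
Unset Strict Implicit.
Unset Printing Implicit Defensive.
Import Order.TTheory GRing.Theory Num.Theory.
Local Open Scope ring_scope.

Definition pideal (R : finComUnitRingType) (c a : R) : bool :=
  [exists b : R, a == c * b].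

Definition addchar (R : finComUnitRingType) (phi : R -> algC) : Prop :=
  phi 0 = 1 /\ forall a b, phi (a + b) = phi a * phi b.

Definition primitive_char (R : finComUnitRingType) (w : R) (l : nat)
    (phi : R -> algC) : Prop :=
  addchar phi /\ exists a : R, phi (w ^+ l.-1 * a) != 1.

Section Groups.
Variables (R : finComUnitRingType) (n : nat).
Local Notation gT := {'GL_n[R]}.

Definition SLset : {set gT} := [set g : gT | \det (GLval g) == 1].

Lemma SL_group_set : group_set SLset.
Proof.
apply/group_setP; split; first by rewrite inE GL_1E det1.
by move=> x y; rewrite !inE GL_MxE det_mulmx => /eqP-> /eqP->; rewrite mulr1.
Qed.
Canonical SL_group := Group SL_group_set.

Definition Uset : {set gT} :=
  [set g : gT | [forall i : 'I_n.-1.+1, forall j : 'I_n.-1.+1,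
     ((j < i)%N ==> (GLval g i j == 0)) && ((i == j) ==> (GLval g i j == 1))]].

Lemma U_group_set : group_set Uset.
Proof.
apply/group_setP; split.
  rewrite inE; apply/forallP=> i; apply/forallP=> j; rewrite GL_1E !mxE.
  case: (eqVneq i j) => [->|nij]; first by rewrite ltnn eqxx.
  by rewrite mulr0n eqxx implybT.
move=> x y; rewrite !inE => /forallP Hx /forallP Hy.
apply/forallP=> i; apply/forallP=> j; rewrite GL_MxE !mxE.
have Lx (a b : 'I_n.-1.+1) : (b < a)%N -> GLval x a b = 0 :> R.
  by move=> h; have /forallP/(_ b)/andP[/implyP/(_ h)/eqP -> _] := Hx a.
have Ly (a b : 'I_n.-1.+1) : (b < a)%N -> GLval y a b = 0 :> R.
  by move=> h; have /forallP/(_ b)/andP[/implyP/(_ h)/eqP -> _] := Hy a.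
have Dx (a : 'I_n.-1.+1) : GLval x a a = 1.
  by have /forallP/(_ a)/andP[_ /implyP/(_ (eqxx a))/eqP ->] := Hx a.
have Dy (a : 'I_n.-1.+1) : GLval y a a = 1.
  by have /forallP/(_ a)/andP[_ /implyP/(_ (eqxx a))/eqP ->] := Hy a.
apply/andP; split; apply/implyP=> h.
  rewrite big1 // => m _.
  case: (ltnP m i) => him; first by rewrite Lx ?mul0r.
  by rewrite Ly ?mulr0 // (leq_trans h him).
move/eqP: h => <-.
rewrite (bigD1 i) //= Dx Dy mulr1 big1 ?addr0 // => m nmi.
case: (ltngtP m i) => him.
- by rewrite Lx ?mul0r.
- by rewrite Ly ?mulr0.
- by move: nmi; rewrite (val_inj (esym him)) eqxx.
Qed.
Canonical U_group := Group U_group_set.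

Variables (w : R) (l : nat).

Definition Kset : {set gT} :=
  [set g : gT | [forall i : 'I_n.-1.+1, forall j : 'I_n.-1.+1,
     pideal (w ^+ l.-1) (GLval g i j - (1%:M : 'M[R]_n.-1.+1) i j)]].

Lemma K_group_set : group_set Kset.
Proof.
apply/group_setP; split.
  rewrite inE; apply/forallP=> i; apply/forallP=> j; rewrite GL_1E subrr.
  by apply/existsP; exists 0; rewrite mulr0.
move=> x y Kx Ky.
have E (z : gT) : z \in Kset -> exists B : 'M[R]_n.-1.+1,
    GLval z = 1%:M + w ^+ l.-1 *: B.
  rewrite inE => /forallP Hz.
  have c i j : {b : R | GLval z i j - (1%:M : 'M[R]_n.-1.+1) i j = w ^+ l.-1 * b}.
    have /forallP/(_ j)/existsP := Hz i.
    by case/sigW=> b /eqP e; exists b.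
  exists (\matrix_(i, j) sval (c i j)); apply/matrixP=> i j.
  by rewrite !mxE -(svalP (c i j)) !mxE addrC subrK.
have [Bx ex] := E x Kx.
have [By ey] := E y Ky.
have key : GLval (x * y) - 1%:M =
    w ^+ l.-1 *: (Bx + By + w ^+ l.-1 *: (Bx *m By)).
  rewrite GL_MxE ex ey mulmxDl !mulmxDr !mul1mx mulmx1 -scalemxAl -scalemxAr.
  rewrite scalerA !scalerDr scalerA.
  by rewrite addrAC [1%:M + _]addrC addrK addrA [w ^+ l.-1 *: Bx + _]addrC.
rewrite inE; apply/forallP=> i; apply/forallP=> j; apply/existsP.
exists ((Bx + By + w ^+ l.-1 *: (Bx *m By)) i j); apply/eqP.
by move: (congr1 (fun M : 'M[R]_n.-1.+1 => M i j) key); rewrite /= !mxE => ->.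
Qed.
Canonical K_group := Group K_group_set.
End Groups.

Section Chars.
Variables (R : finComUnitRingType) (n : nat).
Local Notation gT := {'GL_n[R]}.

(* the class function of G given by f on G (and 0 off G); it is the
   junk value 0 if f is not constant on G-conjugacy classes, which never
   happens for the functions used below *)
Definition cf_of (G : {group gT}) (f : gT -> algC) : 'CF(G) :=
  insubd (0 : 'CF(G)) [ffun x => if x \in G then f x else 0].

Variables (w : R) (l : nat) (k : finFieldType) (red : {rmorphism R -> k}).

Local Notation GL := ([set: gT]%G).
Local Notation SL := (@SL_group R n).
Local Notation U := (@U_group R n).
Local Notation KGL := (@K_group R n w l).
Local Notation KSL := (KGL :&: SL)%G.

(* phi_x(I + w^(l-1) y) = phi(w^(l-1) tr(x^ y)), with X a lift x^ of x;
   note w^(l-1) tr(X y) = tr(X (g - 1)) for g = I + w^(l-1) y *)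
Definition phiX (K : {group gT}) (phi : R -> algC) (X : 'M[R]_n.-1.+1) : 'CF(K) :=
  cf_of K (fun g => phi (\tr (X *m (GLval g - 1%:M)))).

Definition regular_mx (x : 'M[k]_n.-1.+1) : bool := char_poly x == mxminpoly x.

Definition regular_GL (phi0 : R -> algC) (chi : 'CF(GL)) : Prop :=
  exists X : 'M[R]_n.-1.+1,
    regular_mx (map_mx red X) /\ '['Res[KGL] chi, phiX KGL phi0 X] != 0.

Definition regular_SL (phi0 : R -> algC) (chi : 'CF(SL)) : Prop :=
  exists X : 'M[R]_n.-1.+1,
    [/\ \tr (map_mx red X) = 0, regular_mx (map_mx red X) &
        '['Res[KSL] chi, phiX KSL phi0 X] != 0].

Definition theta (phis : 'I_n.-1 -> R -> algC) : 'CF(U) :=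
  cf_of U (fun g => \prod_(i < n.-1) phis i (GLval g (inord i) (inord i.+1))).

(* Hom(delta, Ind_U^SL theta) <> 0, in terms of characters *)
Definition has_whittaker (chi : 'CF(SL)) (th : 'CF(U)) : bool :=
  '[chi, 'Ind[SL] th] != 0.

Definition special_regular (phi0 : R -> algC) (chi : 'CF(SL)) : Prop :=
  exists2 psi, psi \in irr GL & regular_GL phi0 psi /\ 'Res[SL] psi = chi.

End Chars.

(* Main.v *)
(* Diagonal matrices permute the non-degenerate characters of U transitively, so
   one may fix theta (u) = phi (sum of the superdiagonal of u). The key point is
   that a regular irreducible representation psi of GL contains theta exactly
   once. If chi lies below psi, Clifford theory writes the restriction of psi
   to SL as e times the sum of the GL-conjugates of chi. When chi has all
   Whittaker models, each conjugate contains theta, so multiplicity one forces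
   e = 1 and a single conjugate; conversely a restriction inherits theta and
   all its diagonal conjugates from psi.

   For multiplicity at most one, transposition in the anti-diagonal preserves
   theta, and by Gelfand's trick it suffices that a function on GL which is
   theta-equivariant under U on both sides and antisymmetric for it vanishes.
   The Fourier components of such a function along 1 + w^m M_n, m = ceil(l/2),
   are indexed by Hessenberg matrices X and reduce to elements c (1 + w^m' kap)
   with c centralizing X and m' = l - m. For even l the factor with kap is
   absorbed; for odd l a duality argument over the residue field, of odd
   characteristic, makes kap invariant under an anti-involution fixing the
   centralizer of X. Existence of theta is a descent from the principal
   congruence subgroup of level l - 1 to U, one power of w at a time. *)
Require Import Defs.
From HB Require Import structures.
From mathcomp Require Import all_boot all_order all_algebra all_fingroup all_solvable all_field all_character.
From mathcomp Require Import zify ring.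
Import Order.TTheory GRing.Theory Num.Theory.
Local Open Scope ring_scope.
Set Implicit Arguments.
Unset Strict Implicit.
Unset Printing Implicit Defensive.

(** * Hessenberg matrices *)

Section Hessenberg.
Variables (R : comUnitRingType) (n : nat).
Implicit Types (X Y A B D y v : 'M[R]_n.+1).

Definition upper A := forall i j : 'I_n.+1, (j < i)%N -> A i j = 0.
Definition strict_upper A := forall i j : 'I_n.+1, (j <= i)%N -> A i j = 0.
Definition unipotent A := strict_upper (A - 1).
(** The ones on the subdiagonal make the first basis vector e_0 cyclic for [X], and make [X] pair
    with strictly upper matrices like the exponent of the standard Whittaker character. *)
Definition hess X :=
  forall i j : 'I_n.+1, (j < i)%N -> X i j = (i == j.+1 :> nat)%:R.
(* Transposition in the anti-diagonal: an anti-involution preserving the upper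
   triangular, the unipotent and the Hessenberg matrices. *)
Definition star A : 'M[R]_n.+1 := \matrix_(i, j) A (rev_ord j) (rev_ord i).
(** The columns are e_0, X e_0, X^2 e_0, ..., the candidate cyclic basis generated by e_0. *)
Definition krylov X : 'M[R]_n.+1 := \matrix_(i, j) (X ^+ j) i ord0.

Lemma trace_mul_delta A (i j : 'I_n.+1) : \tr (A * delta_mx j i) = A i j.
Proof.
rewrite -mulmxE /mxtrace (bigD1 i) //= mxE (bigD1 j) //= !mxE !eqxx mulr1.
rewrite !big1 ?addr0 // => a /negbTE ai; last by rewrite mxE ai mulr0.
by rewrite mxE big1 // => b _; rewrite mxE ai andbF mulr0.
Qed.

Lemma trace_mulC A B : \tr (A * B) = \tr (B * A).
Proof. exact: mxtrace_mulC. Qed.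

Lemma strict_upper_add A B :
  strict_upper A -> strict_upper B -> strict_upper (A + B).
Proof. by move=> hA hB i j ij; rewrite mxE hA // hB // addr0. Qed.

Lemma strict_upperN A : strict_upper A -> strict_upper (- A).
Proof. by move=> hA i j ij; rewrite mxE hA // oppr0. Qed.

Lemma strict_upperZ a A : strict_upper A -> strict_upper (a *: A).
Proof. by move=> hA i j ij; rewrite mxE hA // mulr0. Qed.

Lemma upper_add A B : upper A -> upper B -> upper (A + B).
Proof. by move=> hA hB i j ij; rewrite mxE hA // hB // addr0. Qed.

Lemma upper_mul A B : upper A -> upper B -> upper (A * B).
Proof.
move=> hA hB i j ji; rewrite -mulmxE mxE big1 // => m _.
have [mi|im] := ltnP m i; first by rewrite hA ?mul0r.
by rewrite (hB m j) ?mulr0 // (leq_trans ji).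
Qed.

Lemma unipotentP A :
  unipotent A <-> upper A /\ (forall i, A i i = 1).
Proof.
split=> [h|[hu hd] i j].
  split=> [i j ji|i].
    have := h i j (ltnW ji); rewrite !mxE.
    by have [e|_] := eqVneq i j; [rewrite e ltnn in ji | rewrite subr0].
  by have := h i i (leqnn i); rewrite !mxE eqxx => /eqP; rewrite subr_eq0 => /eqP.
rewrite leq_eqVlt => /orP[/eqP e|ji]; rewrite !mxE.
  by rewrite (val_inj e) hd eqxx subrr.
by rewrite hu // (_ : i == j = false) ?subr0 // -val_eqE gtn_eqF.
Qed.

Lemma unipotent_upper A : unipotent A -> upper A.
Proof. by case/unipotentP. Qed.

Lemma unipotent_strict A : strict_upper A -> unipotent (1 + A).
Proof. by move=> h; rewrite /unipotent addrC addKr. Qed.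

Lemma unipotent_unit A : unipotent A -> A \is a GRing.unit.
Proof.
case/unipotentP=> hu hd; rewrite -[_ \is a _]/(A \in unitmx) unitmxE -det_tr.
rewrite det_trig; last first.
  by apply/is_trig_mxP=> i j ij; rewrite mxE hu.
by rewrite big1 ?unitr1 // => i _; rewrite mxE hd.
Qed.

Lemma strict_upper_cancelr A B :
  unipotent B -> strict_upper (A * B) -> strict_upper A.
Proof.
case/unipotentP=> hu hd hAB i j.
(* Strong induction on the column: column j of A B is column j of A plus multiples of earlier
   columns of A. *)
move: {2}(j : nat) (leqnn j) => b; elim: b j => [|b IH] j jb ji.
  have := hAB i j ji; rewrite -mulmxE mxE (bigD1 j) //= hd mulr1 big1 ?addr0 //.
  move=> m mj; rewrite hu ?mulr0 // ltn_neqAle eq_sym mj /=.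
  by rewrite (leq_trans jb).
have := hAB i j ji; rewrite -mulmxE mxE (bigD1 j) //= hd mulr1 big1 ?addr0 //.
move=> m mj; have [lt_mj|le_jm] := ltnP m j.
  by rewrite (IH m) ?mul0r //; lia.
by rewrite hu ?mulr0 // ltn_neqAle le_jm andbT eq_sym.
Qed.

Lemma unipotent_cancelr A B : unipotent B -> unipotent (A * B) -> unipotent A.
Proof.
move=> hB hAB; apply: (strict_upper_cancelr hB).
rewrite mulrBl mul1r -[A * B](subrK 1) -addrA; apply: strict_upper_add => //.
by rewrite -opprB; apply: strict_upperN.
Qed.

Lemma unipotent1 : unipotent 1.
Proof. by move=> i j _; rewrite subrr mxE. Qed.

Lemma unipotentV A : unipotent A -> unipotent A^-1.
Proof.
move=> hA; apply: (unipotent_cancelr hA).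
by rewrite mulVr ?unipotent_unit //; apply: unipotent1.
Qed.

Lemma starD A B : star (A + B) = star A + star B.
Proof. by apply/matrixP=> i j; rewrite !mxE. Qed.

Lemma starZ a A : star (a *: A) = a *: star A.
Proof. by apply/matrixP=> i j; rewrite !mxE. Qed.

Lemma star1 : star 1 = 1.
Proof. by apply/matrixP=> i j; rewrite !mxE (inj_eq rev_ord_inj) eq_sym. Qed.

Lemma starK : involutive star.
Proof. by move=> A; apply/matrixP=> i j; rewrite !mxE !rev_ordK. Qed.

Lemma starM A B : star (A * B) = star B * star A.
Proof.
apply/matrixP=> i j; rewrite -!mulmxE !mxE (reindex_inj rev_ord_inj).
by apply: eq_bigr => m _; rewrite !mxE mulrC.
Qed.

Lemma star_trace A : \tr (star A) = \tr A.
Proof.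
rewrite /mxtrace (reindex_inj rev_ord_inj).
by apply: eq_bigr => m _; rewrite !mxE !rev_ordK.
Qed.

Lemma star_unit A : (star A \is a GRing.unit) = (A \is a GRing.unit).
Proof.
have aux B : B \is a GRing.unit -> star B \is a GRing.unit.
  move=> uB; apply/unitrP; exists (star B^-1).
  by rewrite -!starM mulVr // mulrV // star1.
by apply/idP/idP=> /aux //; rewrite starK.
Qed.

Lemma rev_ord_le (i j : 'I_n.+1) :
  (rev_ord j <= rev_ord i)%N = (i <= j)%N.
Proof. by rewrite /= !subSS leq_sub2lE // -ltnS. Qed.

Lemma star_strict_upper A : strict_upper A -> strict_upper (star A).
Proof. by move=> h i j ji; rewrite mxE h // rev_ord_le. Qed.

Lemma star_upper A : upper A -> upper (star A).
Proof. by move=> h i j ji; rewrite mxE h // ltnNge rev_ord_le -ltnNge. Qed.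

Lemma star_unipotent A : unipotent A -> unipotent (star A).
Proof.
move=> h; rewrite -[A](subrK 1) addrC starD star1.
by apply: unipotent_strict; apply: star_strict_upper.
Qed.

Lemma star_hess X : hess X -> hess (star X).
Proof.
move=> h i j ji; rewrite mxE h; last by rewrite ltnNge rev_ord_le -ltnNge.
by congr (nat_of_bool _)%:R; have := ltn_ord i; rewrite /= !subSS; lia.
Qed.

(** [X] sends e_j to e_(j+1) plus a combination of e_0, ..., e_j, so X^j e_0 is e_j plus earlier
    basis vectors. *)
Lemma hess_krylov X : hess X -> unipotent (krylov X).
Proof.
move=> hX; suff H (j : nat) (i : 'I_n.+1) : (j <= i)%N ->
    (X ^+ j) i ord0 = (i == j :> nat)%:R.
  apply/unipotentP; split=> [i j ji|i]; rewrite mxE H ?eqxx //; last exact: ltnW.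
  by rewrite gtn_eqF.
elim: j i => [|j IH] i ji; first by rewrite expr0 mxE -val_eqE.
rewrite exprS -mulmxE mxE.
have jn : (j < n.+1)%N by rewrite (leq_trans ji) // ltnW.
rewrite (bigD1 (Ordinal jn)) //= IH // eqxx mulr1 hX //= big1 ?addr0 // => m mj.
have [ltmj|lejm] := ltnP m j.
  rewrite hX ?(leq_trans ltmj) ?(ltnW ji) //.
  by rewrite gtn_eqF ?mul0r // (leq_ltn_trans ltmj).
rewrite IH // (_ : (m == j :> nat) = false) ?mulr0 //.
by rewrite -(inj_eq val_inj) /= in mj; apply: negbTE.
Qed.

Lemma krylov_mul A X i (j : 'I_n.+1) : (A * krylov X) i j = (A * X ^+ j) i ord0.
Proof. by rewrite -!mulmxE !mxE; apply: eq_bigr => m _; rewrite !mxE. Qed.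

Lemma intertwine_exp v X Y j : v * X = Y * v -> v * X ^+ j = Y ^+ j * v.
Proof.
move=> e; elim: j => [|j IH]; first by rewrite mulr1 mul1r.
by rewrite exprSr mulrA IH -mulrA e mulrA -exprSr.
Qed.

(** Since v X^j e_0 = Y^j v e_0 and e_0 is cyclic for [X], an intertwiner is determined by its first
    column. *)
Lemma intertwine_eq0 v X Y :
  hess X -> v * X = Y * v -> (forall i, v i ord0 = 0) -> v = 0.
Proof.
move=> hX e v0; apply: (mulIr (unipotent_unit (hess_krylov hX))).
rewrite mul0r; apply/matrixP=> i j; rewrite krylov_mul (intertwine_exp j e).
by rewrite -mulmxE !mxE big1 // => m _; rewrite v0 mulr0.
Qed.

Lemma horner_mx_poly X d a :
  horner_mx X (\poly_(j < d) a j) = \sum_(j < d) a j *: X ^+ j.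
Proof.
rewrite poly_def rmorph_sum; apply: eq_bigr => j _.
by rewrite /= horner_mxZ rmorphXn /= horner_mx_X.
Qed.

(** The coefficients of [p] are the coordinates of the first column of [A] in the basis of the X^j
    e_0. *)
Lemma hess_poly_col X A : hess X ->
  exists p, forall i, (horner_mx X p) i ord0 = A i ord0.
Proof.
move=> hX; set a := ((krylov X)^-1 * A).
exists (\poly_(j < n.+1) a (inord j) ord0) => i.
rewrite horner_mx_poly summxE.
transitivity ((krylov X * a) i ord0); last first.
  by rewrite /a mulrA mulrV ?mul1r // unipotent_unit //; apply: hess_krylov.
rewrite -mulmxE mxE; apply: eq_bigr => j _.
by rewrite !mxE inord_val mulrC.
Qed.

(** Subtract from [A] the polynomial in [X] with the same first column: the difference commutes with
    [X] and kills e_0. *)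
Lemma hess_centralizer X A :
  hess X -> A * X = X * A -> exists p, A = horner_mx X p.
Proof.
move=> hX cA; have [p hp] := hess_poly_col A hX; exists p.
apply/eqP; rewrite -subr_eq0; apply/eqP; apply: (intertwine_eq0 (X := X) (Y := X)) => //.
  by rewrite mulrBl mulrBr cA; congr (_ - _); apply: (comm_horner_mx p (commr_refl X)).
by move=> i; rewrite !mxE hp subrr.
Qed.

(** Thanks to the ones below the diagonal of [X], entry (i, j-1) of the commutator is [y i j] plus
    terms already known to vanish, so zeros propagate from column to column. *)
Lemma commutator_upper X y : hess X -> upper (y * X - X * y) ->
  (forall i, y i ord0 = 0) -> strict_upper y.
Proof.
move=> hX hD y0 i j.
move: {2}(j : nat) (leqnn j) => j'; elim: j' j i => [|j' IH] j i jj ji.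
  by rewrite (_ : j = ord0) ?y0 //; apply: val_inj; apply/eqP; rewrite -leqn0.
move: jj; rewrite leq_eqVlt => /orP[/eqP ej|]; last by rewrite ltnS => /IH->.
have jn : (j' < n.+1)%N by rewrite ltnW // -ej.
pose j1 := Ordinal jn; have ji1 : (j' < i)%N by rewrite -ej.
have := hD i j1 ji1.
rewrite -!mulmxE !mxE [X in _ - X]big1 ?subr0 => [|m _]; last first.
  have [jm|mj] := leqP j' m; first by rewrite (IH j1) ?mulr0.
  rewrite hX; last by rewrite (leq_trans mj) // ltnW.
  by rewrite gtn_eqF ?mul0r // (leq_ltn_trans mj).
rewrite (bigD1 j) //= hX ?ej //= eqxx mulr1 big1 ?addr0 // => m mj.
have [lt_mj|le_jm] := leqP m j'.
  by rewrite (IH m) ?mul0r // (leq_trans lt_mj) // ltnW.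
rewrite hX //= (_ : (m == j'.+1 :> nat) = false) ?mulr0 //.
by rewrite -ej; apply: negbTE.
Qed.

(** The change of basis taking X^j e_0 to (star X)^j e_0; it will conjugate [X] to [star X]. *)
Definition star_conj X : 'M[R]_n.+1 := krylov (star X) * (krylov X)^-1.

Lemma star_conj_unipotent X : hess X -> unipotent (star_conj X).
Proof.
move=> hX; apply: (unipotent_cancelr (hess_krylov hX)).
rewrite mulrVK; last by apply: unipotent_unit; apply: hess_krylov.
by apply: hess_krylov; apply: star_hess.
Qed.

(** [star X] is the transpose of [X] conjugated by the order-reversing permutation matrix. *)
Lemma char_poly_star X : char_poly (star X) = char_poly X.
Proof.
have JE (S : comNzRingType) (A : 'M[S]_n.+1) :
    row_perm (perm (@rev_ord_inj n.+1)) (col_perm (perm (@rev_ord_inj n.+1)) A)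
    = \matrix_(i, j) A (rev_ord i) (rev_ord j).
  by apply/matrixP=> i j; rewrite !mxE !permE.
rewrite /char_poly; have -> : char_poly_mx (star X) =
    \matrix_(i, j) (char_poly_mx X)^T (rev_ord i) (rev_ord j).
  by apply/matrixP=> i j; rewrite !mxE (inj_eq rev_ord_inj) eq_sym.
rewrite -(det_tr (char_poly_mx X)).
rewrite -JE row_permE col_permE !det_mulmx !det_perm odd_permV.
by rewrite mulrC -mulrA -signr_addb addbb mulr1.
Qed.

(** By construction [star_conj X] takes X^j e_0 to (star X)^j e_0 for j at most n. Cayley-Hamilton,
    with the common characteristic polynomial, extends this to j = n + 1, which is what the last
    column requires. *)
Lemma star_conj_intertwine X :
  hess X -> star_conj X * X = star X * star_conj X.
Proof.
move=> hX; have kX := hess_krylov hX; have uX := unipotent_unit kX.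
have ekE : star_conj X * krylov X = krylov (star X) by rewrite mulrVK.
have low (j : 'I_n.+1) i :
    (star_conj X * X ^+ j) i ord0 = (star X ^+ j) i ord0.
  by rewrite -krylov_mul ekE -[krylov _]mul1r krylov_mul mul1r.
have top (p : {poly R}) i : (size p <= n.+1)%N ->
    (star_conj X * horner_mx X p) i ord0 = (horner_mx (star X) p) i ord0.
  move=> sp; rewrite -[p]coefK !horner_mx_poly mulr_sumr !summxE.
  apply: eq_bigr => j _.
  rewrite -scalerAr mxE [RHS]mxE.
  by have := low (Ordinal (leq_trans (ltn_ord j) sp)) i => /= ->.
have all j i : (j <= n.+1)%N ->
    (star_conj X * X ^+ j) i ord0 = (star X ^+ j) i ord0.
  rewrite leq_eqVlt => /orP[/eqP->|jn]; last exact: (low (Ordinal jn)).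
  have eX (A : 'M[R]_n.+1) : char_poly A = char_poly X ->
      A ^+ n.+1 = horner_mx A ('X^(n.+1) - char_poly X).
    by move=> e; rewrite rmorphB /= rmorphXn /= horner_mx_X -e Cayley_Hamilton subr0.
  rewrite (eX X) // (eX (star X)) ?char_poly_star // top //.
  apply/leq_sizeP => m; rewrite leq_eqVlt coefB coefXn => /orP[/eqP<-|mn].
    have /monicP := char_poly_monic X; rewrite /lead_coef size_char_poly /= => ->.
    by rewrite eqxx subrr.
  by rewrite gtn_eqF // nth_default ?subr0 // size_char_poly.
apply: (mulIr uX); apply/matrixP=> i j.
rewrite krylov_mul -mulrA -exprS all // -[star X * _ * _]mulrA ekE.
by rewrite krylov_mul -exprS.
Qed.

(** Both sides intertwine [X] with [star X] and, being unipotent, have the same first column. *)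
Lemma star_star_conj X : hess X -> star (star_conj X) = star_conj X.
Proof.
move=> hX; apply/eqP; rewrite -subr_eq0; apply/eqP.
apply: (intertwine_eq0 (X := X) (Y := star X)) => // [|i].
  by rewrite mulrBl mulrBr star_conj_intertwine // -{1}[X]starK -!starM
             star_conj_intertwine // starM starK.
have hu := star_conj_unipotent hX.
have := strict_upper_add hu (strict_upperN (star_unipotent hu)).
move=> /(_ i ord0 (leq0n i)); rewrite !mxE opprB addrA subrK => h; apply/eqP.
by rewrite -oppr_eq0 opprB h.
Qed.

(* An anti-involution fixing the centralizer of X pointwise. *)
Definition sigma X A : 'M[R]_n.+1 := (star_conj X)^-1 * star A * star_conj X.

Section Sigma.
Variable X : 'M[R]_n.+1.
Hypothesis hX : hess X.

Let uu : star_conj X \is a GRing.unit.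
Proof. exact/unipotent_unit/star_conj_unipotent. Qed.

Lemma sigmaD A B : sigma X (A + B) = sigma X A + sigma X B.
Proof. by rewrite /sigma starD mulrDr mulrDl. Qed.

Lemma sigmaZ a A : sigma X (a *: A) = a *: sigma X A.
Proof. by rewrite /sigma starZ -scalerAr -scalerAl. Qed.

Lemma sigmaN A : sigma X (- A) = - sigma X A.
Proof. by rewrite -scaleN1r sigmaZ scaleN1r. Qed.

Lemma sigma1 : sigma X 1 = 1.
Proof. by rewrite /sigma star1 mulr1 mulVr. Qed.

Lemma sigmaM A B : sigma X (A * B) = sigma X B * sigma X A.
Proof. move: uu; rewrite /sigma; move: (star_conj X) => u Uu.
by rewrite starM !mulrA mulrK. Qed.

Lemma sigmaK : involutive (sigma X).
Proof.
move=> A; rewrite /sigma; have := star_star_conj hX; move: uu.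
move: (star_conj X) => u Uu su; rewrite !starM starK su.
have -> : star u^-1 = u^-1.
  by apply: (mulIr Uu); rewrite mulVr // -{2}su -starM mulrV // star1.
by rewrite !mulrA mulVr // mul1r -mulrA mulVr // mulr1.
Qed.

Lemma sigma_fix : sigma X X = X.
Proof. by rewrite /sigma -mulrA -star_conj_intertwine // mulKr. Qed.

Lemma sigma_exp j : sigma X (X ^+ j) = X ^+ j.
Proof.
elim: j => [|j IH]; first exact: sigma1.
by rewrite exprSr sigmaM IH sigma_fix -exprS exprSr.
Qed.

(** The centralizer consists of polynomials in [X], and an anti-automorphism fixing [X] fixes its
    powers. *)
Lemma sigma_comm A : A * X = X * A -> sigma X A = A.
Proof.
move=> /(hess_centralizer hX)[p ->]; rewrite -[p]coefK horner_mx_poly.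
have s0 : sigma X 0 = 0 by rewrite -(scale0r 0) sigmaZ !scale0r.
rewrite (big_morph _ sigmaD s0); apply: eq_bigr => j _.
by rewrite sigmaZ sigma_exp.
Qed.

Lemma sigma_trace A : \tr (sigma X A) = \tr A.
Proof. by rewrite /sigma mxtrace_mulC mulmxA mulmxV ?mul1mx ?star_trace. Qed.

Lemma sigma_upper A : upper A -> upper (sigma X A).
Proof.
move=> hA; have hu := star_conj_unipotent hX.
apply: upper_mul; last exact: unipotent_upper.
by apply: upper_mul; [exact/unipotent_upper/unipotentV | exact: star_upper].
Qed.
End Sigma.
End Hessenberg.

Section MapHessenberg.
Variables (R S : comUnitRingType) (f : {rmorphism R -> S}) (n : nat).
Implicit Types X A : 'M[R]_n.+1.

Lemma map_hess X : hess X -> hess (map_mx f X).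
Proof. by move=> h i j ji; rewrite mxE h // rmorph_nat. Qed.

Lemma map_star A : map_mx f (star A) = star (map_mx f A).
Proof. by apply/matrixP=> i j; rewrite !mxE. Qed.

Lemma map_krylov X : map_mx f (krylov X) = krylov (map_mx f X).
Proof. by apply/matrixP=> i j; rewrite !mxE -rmorphXn /= mxE. Qed.

Lemma map_sigma X A : hess X ->
  map_mx f (sigma X A) = sigma (map_mx f X) (map_mx f A).
Proof.
move=> hX; have kX := unipotent_unit (hess_krylov hX).
have uX := unipotent_unit (star_conj_unipotent hX).
have : map_mx f (star_conj X) = star_conj (map_mx f X).
  by rewrite /star_conj rmorphM /= rmorphV //= !map_krylov map_star.
rewrite /sigma; move: (star_conj X) uX => u uu e.
by rewrite !rmorphM /= rmorphV //= e map_star.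
Qed.
End MapHessenberg.

(** * Duality for the trace form *)

Section TraceDuality.
Variables (k : fieldType) (m1 n1 n : nat).
Variable L : 'M[k]_(m1, n1) -> 'M[k]_n.+1.
Hypothesis linL : linear L.
HB.instance Definition _ := GRing.isLinear.Build k _ _ _ L linL.

Lemma trace_mxvec (B : 'M[k]_n.+1) (c : 'cV[k]_(n.+1 * n.+1)) :
  (mxvec B *m c) ord0 ord0 = \tr ((vec_mx c^T)^T *m B).
Proof.
rewrite mxE (reindex _ (curry_mxvec_bij _ _)) /=.
rewrite (eq_bigr (fun p => mxvec B ord0 (mxvec_index p.1 p.2) *
  c (mxvec_index p.1 p.2) ord0)); last by case.
rewrite -(pair_bigA _ (fun i j =>
  mxvec B ord0 (mxvec_index i j) * c (mxvec_index i j) ord0)) /=.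
rewrite exchange_big /=; apply: eq_bigr => j _.
rewrite mxE; apply: eq_bigr => i _.
by rewrite mxvecE !mxE mulrC.
Qed.

(** The image of a linear map is the annihilator of its annihilator. Each column of the cokernel
    matrix is a functional vanishing on the image, written as a trace against some F. *)
Lemma image_trace_dual (B : 'M[k]_n.+1) :
  (forall F : 'M[k]_n.+1, (forall A, \tr (F * L A) = 0) -> \tr (F * B) = 0) ->
  exists A, B = L A.
Proof.
move=> H; suff /submxP[D eD] : (mxvec B <= lin_mx L)%MS.
  exists (vec_mx D); apply: (can_inj mxvecK).
  by rewrite eD -[in LHS](vec_mxK D) mul_vec_lin.
rewrite submxE; apply/eqP/rowP=> j; rewrite [RHS]mxE.
set C := cokermx _.
have eC (A : 'M[k]_n.+1) : (mxvec A *m C) ord0 j = (mxvec A *m col j C) ord0 ord0.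
  by rewrite !mxE; apply: eq_bigr => s _; rewrite !mxE.
rewrite eC trace_mxvec; apply: H => A.
by rewrite -[_ * _]/(_ *m _) -trace_mxvec -eC -mul_vec_lin -mulmxA mulmx_coker mulmx0 mxE.
Qed.
End TraceDuality.

(** * Trace orthogonality for triangular algebras and commutators *)

Section SigmaFixed.
Variables (k : fieldType) (n : nat).
Implicit Types (x c F B v kap : 'M[k]_n.+1).

Definition upper_part (A : 'M[k]_n.+1) : 'M[k]_n.+1 :=
  \matrix_(i, j) if (i <= j)%N then A i j else 0.

Lemma upper_part_upper A : upper (upper_part A).
Proof. by move=> i j ji; rewrite mxE leqNgt ji. Qed.

Lemma upper_trace_dual F :
  (forall B, upper B -> \tr (F * B) = 0) -> strict_upper F.
Proof.
move=> H i j ji.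
have u : upper (delta_mx j i : 'M[k]_n.+1).
  move=> a b ba; rewrite mxE; case: eqP => //= ea; case: eqP => //= eb.
  by move: ba ji; rewrite ea eb ltnNge => /negbTE->.
by have := H _ u; rewrite trace_mul_delta.
Qed.

(** By duality: a matrix orthogonal to the upper triangular algebra b and to c^-1 b c is a strictly
    upper v with c v c^-1 strictly upper. *)
Lemma upper_sum_conj c B : c \is a GRing.unit ->
  (forall v, strict_upper v -> strict_upper (c * v * c^-1) -> \tr (v * B) = 0) ->
  exists B1 B2, [/\ upper B1, upper B2 & B = B1 + c^-1 * B2 * c].
Proof.
move=> uc H.
(* Stacking two matrices presents the sum of two spaces as the image of one linear map. *)
pose L (A : 'M[k]_(n.+1 + n.+1, n.+1)) :=
  upper_part (usubmx A) + c^-1 * upper_part (dsubmx A) * c.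
have linL : linear L.
  move=> a A A'; have up C C' : upper_part (a *: C + C') =
      a *: upper_part C + upper_part C'.
    by apply/matrixP=> i j; rewrite !mxE; case: ifP; rewrite ?mulr0 ?addr0.
  rewrite /L !linearD !linearZ /= !up mulrDr mulrDl -scalerAr -scalerAl.
  by rewrite addrACA.
have upE B1 : upper B1 -> upper_part B1 = B1.
  by move=> h; apply/matrixP=> i j; rewrite mxE; case: leqP => // /h->.
have up0 : upper (0 : 'M[k]_n.+1) by move=> i j _; rewrite mxE.
have LE B1 B2 : upper B1 -> upper B2 -> L (col_mx B1 B2) = B1 + c^-1 * B2 * c.
  by move=> h1 h2; rewrite /L col_mxKu col_mxKd !upE.
have [|A ->] := image_trace_dual linL (B := B).
  move=> F hF; apply: H; apply: upper_trace_dual => B' hB'.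
    by have := hF (col_mx B' 0); rewrite LE // mulr0 mul0r addr0.
  have := hF (col_mx 0 B'); rewrite LE // add0r => <-.
  by rewrite -!mulrA trace_mulC -!mulrA.
by exists (upper_part (usubmx A)), (upper_part (dsubmx A)); split => //;
  apply: upper_part_upper.
Qed.

(** The orthogonal of the image of y -> [y, x] is the centralizer of x, spanned by the powers of
    x. *)
Lemma commutator_image x B : hess x ->
  (forall j, \tr (B * x ^+ j) = 0) -> exists y, B = y * x - x * y.
Proof.
move=> hx H; pose L y := y * x - x * y.
have linL : linear L.
  move=> a A A'; rewrite /L mulrDl mulrDr -scalerAl -scalerAr scalerBr.
  by rewrite opprD addrACA.
apply: (image_trace_dual linL) => F hF.
have cF : F * x = x * F.
  apply/eqP; rewrite -subr_eq0; apply/eqP/matrixP=> i j; rewrite [RHS]mxE.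
  have := hF (delta_mx j i); rewrite /L mulrBr linearB /= mulrA.
  rewrite -!mulmxE [X in X - _]mxtrace_mulC !mulmxA -linearB /= -mulmxBl mulmxE.
  move=> /eqP; rewrite -oppr_eq0 -linearN /= -mulNr opprB => /eqP <-.
  by rewrite trace_mul_delta.
have [p ->] := hess_centralizer hx cF.
rewrite -[_ * _]/(_ *m _) mxtrace_mulC -[p]coefK horner_mx_poly -[_ *m _]/(_ * _).
rewrite mulr_sumr linear_sum big1 // => j _.
by rewrite -scalerAr linearZ /= H mulr0.
Qed.

(* The trace condition puts [x, kap] in b + c^-1 b c, where b is the upper
   triangular algebra; applying 1 + tau gives [x, kap - tau kap] = b' + tau b'
   with b' upper and orthogonal to k[x], so b' is a commutator [x, v]. *)
Lemma sigma_fixed_rep x c kap : (2%:R : k) != 0 -> hess x ->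
  c * x = x * c -> c \is a GRing.unit ->
  (forall v, strict_upper v -> strict_upper (c * v * c^-1) ->
     \tr (x * (kap * v - v * kap)) = 0) ->
  exists2 v, strict_upper v & c^-1 * sigma x (kap - v) * c = kap - v.
Proof.
move=> n2 hx cx uc H; pose tau A := c^-1 * sigma x A * c.
have tauD A B : tau (A + B) = tau A + tau B.
  by rewrite /tau sigmaD mulrDr mulrDl.
have tauN A : tau (- A) = - tau A by rewrite /tau sigmaN mulrN mulNr.
have sc : sigma x c = c by apply: sigma_comm.
have cVx : c^-1 * x = x * c^-1.
  by apply: (mulrI uc); rewrite mulVKr // mulrA cx -mulrA mulrV // mulr1.
have scV : sigma x c^-1 = c^-1 by apply: sigma_comm.
have tauK A : tau (tau A) = A.
  rewrite /tau (sigmaM hx _ c) (sigmaM hx c^-1) sc scV sigmaK //.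
  by rewrite mulKr // -mulrA mulVr ?mulr1.
have tau_tr A : \tr (tau A) = \tr A.
  by rewrite /tau -!mulmxE mxtrace_mulC mulmxA mulmxV // mul1mx sigma_trace.
have tau_comm A : A * x = x * A -> tau A = A.
  move=> cA; rewrite /tau sigma_comm //.
  have [p pA] := hess_centralizer hx cA; have [q qc] := hess_centralizer hx cx.
  have -> : c^-1 * A * c = c^-1 * (c * A).
    by rewrite -mulrA pA qc -!rmorphM mulrC.
  by rewrite mulKr.
pose ad A := A * x - x * A.
have adD A B : ad (A + B) = ad A + ad B.
  by rewrite /ad mulrDl mulrDr opprD addrACA.
have adN A : ad (- A) = - ad A by rewrite /ad mulNr mulrN opprB opprK addrC.
have tau_ad A : tau (ad A) = - ad (tau A).
  rewrite /tau /ad sigmaD sigmaN !sigmaM // sigma_fix // mulrBr mulrBl opprB.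
  by rewrite !mulrA cVx -!mulrA cx.
have [B1 [B2 [h1 h2 eB]]] : exists B1 B2,
    [/\ upper B1, upper B2 & ad kap = B1 + c^-1 * B2 * c].
  apply: upper_sum_conj => // v hv hcv; have := H v hv hcv.
  rewrite mulrBr linearB /= => /eqP; rewrite subr_eq0 => /eqP e.
  apply/eqP; rewrite mulrBr linearB /= subr_eq0; apply/eqP.
  by rewrite mulrA trace_mulC -e mulrA trace_mulC.
pose b := B1 + sigma x B2.
have ub : upper b by apply: upper_add => //; apply: sigma_upper.
have eb : ad (kap - tau kap) = b + tau b.
  rewrite adD adN -tau_ad eB tauD /b tauD addrACA [in LHS]addrA.
  have -> : tau (c^-1 * B2 * c) = sigma x B2.
    rewrite /tau (sigmaM hx _ c) (sigmaM hx c^-1) sc scV.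
    by rewrite mulKr // -mulrA mulVr ?mulr1.
  rewrite -[tau (sigma x B2)]/(c^-1 * _ * c) sigmaK //.
  by rewrite [RHS]addrAC !addrA.
clearbody b.
(* [b] and [tau b] have the same trace against x^j, their sum is a commutator with x, and 2 is
   invertible. *)
have b_orth j : \tr (b * x ^+ j) = 0.
  apply: (mulfI n2); rewrite mulr0.
  have -> : 2%:R * \tr (b * x ^+ j) = \tr ((b + tau b) * x ^+ j).
    rewrite mulr_natl mulr2n mulrDl mxtraceD; congr (_ + _).
    have cj : c * x ^+ j = x ^+ j * c by apply: intertwine_exp.
    have -> : tau b * x ^+ j = tau (x ^+ j * b).
      by rewrite /tau sigmaM // sigma_exp // -!mulrA cj.
    by rewrite tau_tr trace_mulC.
  rewrite -eb /ad mulrBl raddfB /= -!mulrA -exprS exprSr.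
  rewrite -[x * _]/(_ *m _) [X in _ - X]mxtrace_mulC.
  by rewrite -[_ *m _]/(_ * _) -mulrA -exprSr exprS subrr.
have [y ey] := commutator_image hx b_orth.
have [p hp] := hess_poly_col y hx.
(* Subtracting a polynomial in x clears the first column without changing the commutator, as
   [commutator_upper] demands. *)
pose v := y - horner_mx x p.
have adv : ad v = b.
  have cp : ad (horner_mx x p) = 0.
    apply/eqP; rewrite subr_eq0; apply/eqP.
    exact: (comm_horner_mx p (commr_refl x)).
  by rewrite adD adN cp oppr0 addr0 ey.
have sv : strict_upper v.
  by apply: (commutator_upper hx); [rewrite -/(ad v) adv | move=> i; rewrite !mxE hp subrr].
exists v => //; rewrite -/(tau _).
(* [z] is antisymmetric under [tau]; it also commutes with x, hence is fixed by [tau], so 2 z =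
   0. *)
pose z := (kap - v) - tau (kap - v).
have tz : tau z = - z.
  by rewrite /z; move: (kap - v) => A; rewrite tauD tauN tauK opprB.
have cz : z * x = x * z.
  apply/eqP; rewrite -subr_eq0 -/(ad z) /z adD adN -tau_ad.
  rewrite adD adN adv tauD tauN [_ + (_ - _)]addrACA -opprD.
  rewrite -[tau (ad kap)]opprK tau_ad opprK.
  by rewrite -adN -adD eb subrr.
have : z *+ 2 = 0.
  by rewrite mulr2n -{1}[z]tau_comm // tz addNr.
rewrite -scaler_nat => /eqP; rewrite scaler_eq0 (negbTE n2) /= subr_eq0.
by move=> /eqP.
Qed.
End SigmaFixed.

(** * The projector of a linear character of a subgroup *)

Section LinearProjector.
Variables (gT : finGroupType) (H : {group gT}) (d : nat).
Variable rho : mx_representation algC [set: gT] d.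
Variable lam : 'CF(H).
Hypothesis lam_lin : lam \is a linear_char.

Lemma hom_linear_char (L : 'CF(H)) (f : gT -> algC) :
  {in H, L =1 f} -> f 1%g = 1 -> {in H &, {morph f : x y / (x * y)%g >-> x * y}} ->
  L \is a linear_char.
Proof.
move=> Lf f1 fM.
have rP : mx_repr H (fun g => (f g)%:M : 'M[algC]_1).
  by split=> [|x y Hx Hy]; rewrite ?f1 // fM // scalar_mxM.
have -> : L = cfRepr (MxRepresentation rP).
  by apply/cfun_inP=> x Hx; rewrite cfunE Hx mulr1n /= mxtrace_scalar mulr1n Lf.
by rewrite qualifE /= cfRepr_char cfRepr1 eqxx.
Qed.

Definition lin_proj : 'M[algC]_d :=
  #|H|%:R^-1 *: \sum_(x in H) lam x^-1%g *: rho x.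

Lemma card_H_neq0 : #|H|%:R != 0 :> algC.
Proof. by rewrite pnatr_eq0 -lt0n cardG_gt0. Qed.

Lemma rhoM x y : rho (x * y)%g = rho x *m rho y.
Proof. by apply: repr_mxM; rewrite inE. Qed.

Lemma lin_proj_trace : \tr lin_proj = '['Res[H] (cfRepr rho), lam].
Proof.
rewrite mxtraceZ raddf_sum /= cfdotE; congr (_ * _); apply: eq_bigr => x Hx.
rewrite mxtraceZ cfResE ?subsetT // cfunE inE mulr1n mulrC.
by rewrite (lin_charV_conj lam_lin).
Qed.

Lemma lin_projl x : x \in H -> rho x *m lin_proj = lam x *: lin_proj.
Proof.
move=> Hx; rewrite -scalemxAr scalerA mulrC -scalerA; congr (_ *: _).
rewrite mulmx_sumr scaler_sumr (reindex_inj (mulgI x^-1%g)) /=.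
apply: eq_big => [y|y Hy]; first by rewrite groupMl ?groupV.
rewrite -scalemxAr -rhoM mulKVg scalerA; congr (_ *: _).
have Hy' : y \in H by rewrite -[y](mulKVg x) groupM.
by rewrite invMg invgK lin_charM ?groupV // mulrC.
Qed.

Lemma lin_projr x : x \in H -> lin_proj *m rho x = lam x *: lin_proj.
Proof.
move=> Hx; rewrite -scalemxAl scalerA mulrC -scalerA; congr (_ *: _).
rewrite mulmx_suml scaler_sumr (reindex_inj (mulIg x^-1%g)) /=.
apply: eq_big => [y|y Hy]; first by rewrite groupMr ?groupV.
rewrite -scalemxAl -rhoM mulgKV scalerA; congr (_ *: _).
have Hy' : y \in H by rewrite -[y](mulgKV x) groupM.
by rewrite invMg invgK lin_charM ?groupV.
Qed.

Lemma lin_proj_fix (A : 'M[algC]_d) :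
  (forall x, x \in H -> rho x *m A = lam x *: A) -> lin_proj *m A = A.
Proof.
move=> hA; rewrite -scalemxAl mulmx_suml (eq_bigr (fun=> A)) => [|x Hx].
  by rewrite sumr_const -scaler_nat scalerA mulVf ?scale1r // card_H_neq0.
rewrite -scalemxAl hA // scalerA lin_charV // mulVf ?scale1r //.
exact: lin_char_neq0.
Qed.

Lemma lin_proj_idem : lin_proj *m lin_proj = lin_proj.
Proof. by apply: lin_proj_fix => x; apply: lin_projl. Qed.

(** Rows transforming by [lam] are fixed by the projector acting from the right. *)
Lemma lin_proj_neq0 m (A : 'M[algC]_(m, d)) : A != 0 ->
  (forall x, x \in H -> A *m rho x = lam x *: A) -> lin_proj != 0.
Proof.
move=> A0 hA; apply: contraNneq A0 => P0.
have : A *m lin_proj = A.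
  rewrite -scalemxAr mulmx_sumr (eq_bigr (fun=> A)) => [|x Hx].
    by rewrite sumr_const -scaler_nat scalerA mulVf ?scale1r // card_H_neq0.
  rewrite -scalemxAr hA // scalerA lin_charV // mulVf ?scale1r //.
  exact: lin_char_neq0.
by rewrite P0 mulmx0 => <-.
Qed.

Section GelfandTrick.
Hypothesis rho_irr : mx_irreducible rho.
Variable anti : gT -> gT.
Hypothesis antiM : forall x y, anti (x * y)%g = (anti y * anti x)%g.
Hypothesis antiK : involutive anti.
Hypothesis antiH : forall x, (anti x \in H) = (x \in H).
Hypothesis lam_anti : forall x, lam (anti x) = lam x.
Hypothesis vanish : forall f : gT -> algC,
  (forall u g, u \in H -> f (u * g)%g = lam u * f g) ->
  (forall u g, u \in H -> f (g * u)%g = lam u * f g) ->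
  (forall g, f (anti g) = - f g) -> forall g, f g = 0.

Local Notation P := lin_proj.
Let F g := P *m rho g *m P.

(** Each entry of [F (anti g) - F g] is equivariant on both sides and changes sign under [anti], so
    [vanish] applies. *)
Let F_anti g : F (anti g) = F g.
Proof.
apply/matrixP=> i j; apply/eqP; rewrite -subr_eq0; apply/eqP.
have Fl u x : u \in H -> F (u * x)%g = lam u *: F x.
  by move=> Hu; rewrite /F rhoM mulmxA lin_projr // -!scalemxAl.
have Fr u x : u \in H -> F (x * u)%g = lam u *: F x.
  by move=> Hu; rewrite /F rhoM -!mulmxA lin_projl // -!scalemxAr.
apply: (@vanish (fun g => F (anti g) i j - F g i j)) => [u x Hu|u x Hu|x].
- by rewrite antiM (Fr (anti u)) ?antiH // (Fl u) // lam_anti mxE [X in _ - X]mxE mulrBr.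
- by rewrite antiM (Fl (anti u)) ?antiH // (Fr u) // lam_anti mxE [X in _ - X]mxE mulrBr.
by rewrite antiK opprB.
Qed.

(** A product F a F b is the average of lam(u^-1) F(a u b) over u in H; applying [anti] inside F
    reverses the order of the factors. *)
Let F_comm x y : F x *m F y = F y *m F x.
Proof.
have FM a b : F a *m F b =
    #|H|%:R^-1 *: \sum_(u in H) lam u^-1%g *: F (a * u * b)%g.
  have -> : F a *m F b = (P *m rho a) *m P *m (rho b *m P).
    by rewrite /F !mulmxA -[_ *m P *m P]mulmxA lin_proj_idem.
  rewrite -scalemxAr -scalemxAl; congr (_ *: _).
  rewrite mulmx_sumr mulmx_suml; apply: eq_bigr => u Hu.
  by rewrite -scalemxAr -scalemxAl /F !rhoM !mulmxA.
rewrite FM -(F_anti y) -(F_anti x) FM; congr (_ *: _).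
rewrite (reindex_inj (inv_inj antiK)) /=; apply: eq_big => u; rewrite antiH // => Hu.
rewrite !lin_charV ?antiH // lam_anti; congr (_ *: _).
by rewrite -F_anti !antiM antiK mulgA.
Qed.

(* P *m A *m P and P *m B *m P commute for all A and B, since rho spans the
   matrix algebra; on elementary matrices this is an identity between entries
   of P, which is contracted twice. *)
Lemma gelfand_trace : (\tr P) ^+ 2 *: P = P.
Proof.
have /mx_abs_irrP[_ [a_ a_E]] : mx_absolutely_irreducible rho by apply: groupC.
have comm (A B : 'M[algC]_d) :
    (P *m A *m P) *m (P *m B *m P) = (P *m B *m P) *m (P *m A *m P).
  have Fsum (C : 'M[algC]_d) : P *m C *m P = \sum_(x in [set: gT]) a_ x C *: F x.
    rewrite {1}(a_E C) mulmx_sumr mulmx_suml; apply: eq_bigr => x _.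
    by rewrite /F -[P *m (_ *: _)]scalemxAr [RHS]scalemxAl.
  rewrite !Fsum !mulmx_suml; under eq_bigr => x _ do rewrite mulmx_sumr.
  rewrite exchange_big; apply: eq_bigr => y _; rewrite mulmx_sumr.
  apply: eq_bigr => x _.
  by rewrite -!scalemxAl -!scalemxAr !scalerA F_comm mulrC.
have key a i j k l b : P a i * P j k * P l b = P a k * P l i * P j b.
  have E (A B : 'M[algC]_d) : (P *m A *m P) *m (P *m B *m P) = P *m A *m P *m B *m P.
    by rewrite !mulmxA -[_ *m P *m P]mulmxA lin_proj_idem.
  have D (M : 'M[algC]_d) (i' j' s t : 'I_d) :
      (M *m delta_mx i' j' *m P) s t = M s i' * P j' t.
    rewrite mxE (bigD1 j') //= mxE (bigD1 i') //= mxE !eqxx mulr1.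
    rewrite !big1 ?addr0 // => c /negbTE nc; last by rewrite mxE nc mulr0.
    by rewrite mxE big1 ?mul0r // => e _; rewrite mxE nc andbF mulr0.
  have /matrixP/(_ a b) := comm (delta_mx i j) (delta_mx k l).
  by rewrite !E !D.
have PP i j : \sum_s P i s * P s j = P i j.
  by have /matrixP/(_ i j) := lin_proj_idem; rewrite mxE.
have key2 a i l b : P a i * \tr P * P l b = P l i * P a b.
  rewrite -[X in _ = _ * X]PP [RHS]mulr_sumr /mxtrace mulr_sumr mulr_suml.
  by apply: eq_bigr => j _; rewrite key mulrCA mulrA mulrC.
apply/matrixP=> l b; rewrite mxE -[RHS]PP expr2 {1}/mxtrace !mulr_suml.
apply: eq_bigr => i _; exact: key2.
Qed.

(** The trace of the projector is the multiplicity; its square is 1, and it is a natural number. *)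
Lemma gelfand_dot : lin_proj != 0 -> '['Res[H] (cfRepr rho), lam] = 1.
Proof.
move=> P0; have /eqP : ((\tr P) ^+ 2 - 1) *: P = 0 by rewrite scalerBl scale1r gelfand_trace subrr.
rewrite scaler_eq0 (negbTE P0) orbF subr_eq0 sqrf_eq1 lin_proj_trace.
case/orP=> /eqP // e; have : '['Res[H] (cfRepr rho), lam] \in Num.nat.
  by apply: Cnat_cfdot_char; rewrite ?cfRes_char ?cfRepr_char ?lin_charW.
by move/natr_ge0; rewrite e oppr_ge0 ler10.
Qed.
End GelfandTrick.
End LinearProjector.

(** * Cyclic vectors *)

Section CyclicVector.
Variables (k : finFieldType) (n : nat) (x : 'M[k]_n.+1).
Implicit Types (u v : 'cV[k]_n.+1) (p q d a b c : {poly k}).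

Definition annihilator_gen v d :=
  d != 0 /\ forall p, (horner_mx x p *m v == 0) = (d %| p).

Lemma annihilator_exists v : exists d, annihilator_gen v d.
Proof.
(* Vectors of length n + 2 encode the polynomials of degree at most n + 1, enough to contain the
   characteristic polynomial; the generator is a nonzero annihilator of least size. *)
pose P (r : 'rV[k]_n.+2) := (rVpoly r != 0) && (horner_mx x (rVpoly r) *m v == 0).
have sc : (size (char_poly x) <= n.+2)%N by rewrite size_char_poly.
have P0 : P (poly_rV (char_poly x)).
  rewrite /P poly_rV_K // Cayley_Hamilton mul0mx eqxx andbT.
  by rewrite monic_neq0 ?char_poly_monic.
case: (arg_minnP (fun r => size (rVpoly r)) P0) => r /andP[r0 /eqP rv] rmin.
exists (rVpoly r); split=> // p; apply/idP/idP=> [/eqP pv|]; last first.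
  by move=> /dvdpP[q ->]; rewrite rmorphM /= -mulmxE -mulmxA rv mulmx0.
rewrite /dvdp; apply: contraT => m0.
have sm : (size (p %% rVpoly r)%R < size (rVpoly r))%N by rewrite ltn_modp.
have sr : (size (rVpoly r) <= n.+2)%N by apply: size_poly.
have mv : horner_mx x (p %% rVpoly r) *m v = 0.
  have := pv; rewrite {1}(divp_eq p (rVpoly r)) rmorphD rmorphM /= mulmxDl.
  by rewrite -mulmxE -mulmxA rv mulmx0 add0r.
have := rmin (poly_rV (p %% rVpoly r)); rewrite /P poly_rV_K; last first.
  by rewrite (leq_trans (ltnW sm)).
by rewrite m0 mv eqxx leqNgt sm => /(_ isT).
Qed.

(** If p kills u + v, then b p kills u, so a divides b p and hence p; symmetrically for b. *)
Lemma annihilator_add u v a b : annihilator_gen u a -> annihilator_gen v b ->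
  coprimep a b -> annihilator_gen (u + v) (a * b).
Proof.
move=> [a0 ha] [b0 hb] cab; split; first by rewrite mulf_neq0.
have mulC p q z : horner_mx x (p * q) *m z = horner_mx x p *m (horner_mx x q *m z).
  by rewrite rmorphM mulmxA.
move=> p; rewrite Gauss_dvdp //; apply/idP/andP=> [/eqP pe|[dap dbp]]; last first.
  rewrite mulmxDr; move: dap dbp; rewrite -ha -hb => /eqP-> /eqP->.
  by rewrite addr0.
have au : horner_mx x a *m u = 0 by apply/eqP; rewrite ha.
have bv : horner_mx x b *m v = 0 by apply/eqP; rewrite hb.
split.
  rewrite -(Gauss_dvdpr p cab) -ha mulC.
  have := congr1 (mulmx (horner_mx x b)) pe.
  rewrite mulmx0 mulmxDr mulmxDr -[X in _ + X]mulC [b * p]mulrC mulC bv mulmx0 addr0.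
  by move=> ->.
rewrite -(Gauss_dvdpr p (_ : coprimep b a)) 1?coprimep_sym // -hb mulC.
have := congr1 (mulmx (horner_mx x a)) pe.
rewrite mulmx0 mulmxDr mulmxDr -[X in X + _]mulC [a * p]mulrC mulC au mulmx0 add0r.
by move=> ->.
Qed.

Lemma annihilator_quo u a c : annihilator_gen u (a * c) ->
  annihilator_gen (horner_mx x c *m u) a.
Proof.
move=> [ac0 h]; have := ac0; rewrite mulf_eq0 negb_or => /andP[a0 c0].
split=> // p; rewrite mulmxA mulmxE -rmorphM -[_ (p * c)]/(horner_mx x (p * c)) h.
by rewrite dvdp_mul2r.
Qed.

(* a s (b r) is the least common multiple of p and q. *)
Lemma coprime_lcm p q : p != 0 -> q != 0 -> exists a s b r,
  [/\ p = a * s * r, q = b * r * s & coprimep (a * s) (b * r)].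
Proof.
move=> p0 q0; pose g := gcdp p q.
have g0 : g != 0 by rewrite gcdp_eq0 negb_and p0.
have ep : p = (p %/ g) * g by rewrite divpK // dvdp_gcdl.
have eq : q = (q %/ g) * g by rewrite divpK // dvdp_gcdr.
pose a := p %/ g; pose b := q %/ g.
have cab : coprimep a b by apply: coprimep_div_gcd; rewrite p0.
(* [r] is the largest divisor of the gcd coprime to [a]; the cofactor [s] is then built only from
   primes of [a]. *)
case: (gdcopP a g) => r rg; rewrite (negbTE g0) orbF => cra rmax.
pose s := g %/ r; have eg : g = s * r by rewrite divpK.
have r0 : r != 0 by apply: contraNneq g0 => e; rewrite eg e mulr0.
(* A divisor c of s coprime to a would make c r a divisor of g coprime to a, so c is constant by
   maximality of r. *)
have const c : c %| s -> coprimep c a -> coprimep c 0 .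
  move=> cs ca; rewrite coprimep0.
  have : c * r %| r.
    by apply: rmax; rewrite ?eg ?dvdp_mul2r // coprimepMl ca.
  by rewrite -{2}[r]mul1r dvdp_mul2r // dvdp1 size_poly_eq1.
have cs c : coprimep c a -> coprimep s c.
  move=> ca; rewrite /coprimep size_poly_eq1 -coprimep0.
  apply: const; first exact: dvdp_gcdl.
  exact: coprimep_dvdr (dvdp_gcdr s c) ca.
exists a, s, b, r; split=> //.
- by rewrite -mulrA -eg.
- by rewrite -mulrA [r * s]mulrC -eg.
rewrite coprimepMl !coprimepMr cab (coprimep_sym a r) cra !cs //=.
by rewrite coprimep_sym.
Qed.

Lemma annihilator_merge u v p q : annihilator_gen u p -> annihilator_gen v q ->
  exists z d, [/\ annihilator_gen z d, p %| d & q %| d].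
Proof.
move=> hu hv; have [a [s [b [r [ep eq cop]]]]] := coprime_lcm hu.1 hv.1.
rewrite ep in hu *; rewrite eq in hv *.
exists (horner_mx x r *m u + horner_mx x s *m v), (a * s * (b * r)); split.
- by apply: annihilator_add => //; apply: annihilator_quo.
- by rewrite (mulrC b) mulrA dvdp_mulIl.
by rewrite (_ : a * s * (b * r) = a * (b * r * s)) ?dvdp_mulIr //; ring.
Qed.

(** Merging the annihilators of the basis vectors one at a time yields a vector whose annihilator
    kills every basis vector, hence the whole space. *)
Lemma maximal_annihilator : exists z : 'cV[k]_n.+1, forall p, horner_mx x p *m z = 0 ->
  horner_mx x p = 0.
Proof.
have H (s : seq 'I_n.+1) : exists z d, annihilator_gen z d /\
    forall i, i \in s -> col i (horner_mx x d) = 0.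
  elim: s => [|i s [z [d [hz hs]]]].
    by have [d hd] := annihilator_exists 0; exists 0, d.
  have [e he] := annihilator_exists (delta_mx i ord0).
  have [z' [d' [hz' dd' ed']]] := annihilator_merge hz he.
  exists z', d'; split=> // j; rewrite inE => /orP[/eqP->|/hs dj].
    by rewrite colE; apply/eqP; rewrite he.2.
  by have /dvdpP[c ->] := dd'; rewrite rmorphM /= colE -mulmxE -mulmxA -colE dj mulmx0.
have [z [d [hz hd]]] := H (enum 'I_n.+1); exists z => p /eqP; rewrite hz.2.
case/dvdpP=> c ->; rewrite rmorphM /= (_ : horner_mx x d = 0) ?mulr0 //.
apply/matrixP=> i j; have /matrixP/(_ i ord0) := hd j (mem_enum _ j).
by rewrite !mxE.
Qed.

(** A vector z with minimal annihilator is cyclic when the minimal polynomial has full degree; in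
    the basis x^j z the matrix takes companion form, which is Hessenberg. *)
Lemma regular_hess : char_poly x = mxminpoly x ->
  exists2 g, g \is a GRing.unit & hess (g^-1 * x * g).
Proof.
move=> reg; have [z hz] := maximal_annihilator.
pose g : 'M[k]_n.+1 := \matrix_(i, j) (x ^+ j *m z) i ord0.
have gE (c : 'cV[k]_n.+1) : g *m c = horner_mx x (\poly_(j < n.+1) c (inord j) ord0) *m z.
  rewrite horner_mx_poly mulmx_suml; apply/colP=> i; rewrite mxE summxE.
  apply: eq_bigr => j _; rewrite -scalemxAl [RHS]mxE mxE inord_val mulrC.
  by [].
(* A polynomial of degree at most n killing z kills x, hence is a multiple of the characteristic
   polynomial, of degree n + 1. *)
have ker (c : 'cV[k]_n.+1) : g *m c = 0 -> c = 0.
  rewrite gE => /hz/mxminpoly_min; rewrite -reg => hd.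
  have p0 : \poly_(j < n.+1) c (inord j) ord0 = 0.
    apply/eqP; apply: contraT => pn0; have := dvdp_leq pn0 hd.
    by rewrite size_char_poly ltnNge size_poly.
  apply/colP=> i; have := congr1 (fun q : {poly k} => q`_i) p0.
  by rewrite coef_poly ltn_ord inord_val coef0 mxE.
have ug : g \is a GRing.unit.
  rewrite -[_ \is a _]/(g \in unitmx) -unitmx_tr -row_free_unit -kermx_eq0.
  apply/eqP/row_matrixP=> i; rewrite row0; apply: trmx_inj; rewrite trmx0.
  apply: ker; apply: trmx_inj; rewrite trmx_mul trmxK trmx0.
  by apply/sub_kermxP; rewrite row_sub.
exists g => // i j ji; have jn : (j.+1 < n.+1)%N by rewrite (leq_ltn_trans ji).
have : col j (x * g) = col (Ordinal jn) g.
  apply/colP=> s; rewrite [LHS]mxE [RHS]mxE [RHS]mxE /= exprS -!mulmxE.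
  rewrite -mulmxA [LHS]mxE [RHS]mxE; apply: eq_bigr => t _.
  by rewrite [g _ _]mxE.
move=> e; rewrite -mulrA -[LHS]/((g^-1 *m (x * g)) i j).
have -> : (g^-1 *m (x * g)) i j = (g^-1 *m col j (x * g)) i ord0.
  by rewrite !mxE; apply: eq_bigr => t _; rewrite [col _ _ _ _]mxE.
rewrite e colE mulmxA mulmxE mulVr // -colE !mxE.
by rewrite -val_eqE.
Qed.
End CyclicVector.

(** * Regularity under scalar shifts, and determinants near the identity *)

Lemma regular_mxP (k : fieldType) n (x : 'M[k]_n.+1) :
  reflect (forall p, horner_mx x p = 0 -> (size p <= n.+1)%N -> p = 0)
          (char_poly x == mxminpoly x).
Proof.
apply: (iffP eqP) => [e p /mxminpoly_min|H].
  rewrite -e => hd sp; apply/eqP; apply: contraTT sp => p0.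
  by rewrite -ltnNge -(size_char_poly x) dvdp_leq.
have dv : mxminpoly x %| char_poly x by apply: mxminpoly_min; apply: Cayley_Hamilton.
have := dvdp_leq (monic_neq0 (char_poly_monic x)) dv.
rewrite size_char_poly leq_eqVlt => /orP[/eqP sz|sz]; last first.
  by case/eqP: (monic_neq0 (mxminpoly_monic x)); apply: H (mx_root_minpoly x) sz.
apply/eqP; rewrite eq_sym -eqp_monic ?mxminpoly_monic ?char_poly_monic //.
by rewrite -dvdp_size_eqp // sz size_char_poly.
Qed.

Lemma regular_mx_shift (k : finFieldType) n (x : 'M[k]_n.+1) c :
  char_poly x == mxminpoly x -> char_poly (x + c%:M) == mxminpoly (x + c%:M).
Proof.
move=> /regular_mxP H; apply/regular_mxP => p.
have -> : horner_mx (x + c%:M) p = horner_mx x (p \Po ('X + c%:P)).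
  elim/poly_ind: p => [|p a IH]; first by rewrite comp_poly0 !rmorph0.
  rewrite comp_polyD comp_polyM comp_polyX comp_polyC !rmorphD !rmorphM /= IH.
  by rewrite rmorphD /= !horner_mx_X !horner_mx_C.
move=> /H hp sp; apply/eqP; rewrite -size_poly_eq0.
by rewrite -(size_comp_poly2 p (size_XaddC c)) hp ?size_poly0 // size_comp_poly2 ?size_XaddC.
Qed.

(** A nontrivial permutation moves at least two indices, so its term contains e^2 = 0. *)
Lemma det_1_nilpotent (R : comNzRingType) n (e : R) (T : 'M[R]_n) : e * e = 0 ->
  \det (1%:M + e *: T) = 1 + e * \tr T.
Proof.
move=> ee; rewrite /determinant (bigD1 (1 : 'S_n)%g) //= odd_perm1 expr0 mul1r.
rewrite [X in _ + X]big1 ?addr0 => [|s s1].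
  have H (r : seq 'I_n) : \prod_(i <- r) (1%:M + e *: T) i ((1 : 'S_n)%g i) =
      1 + e * \sum_(i <- r) T i i.
    elim: r => [|i r IH]; first by rewrite !big_nil mulr0 addr0.
    rewrite !big_cons IH perm1 !mxE eqxx mulr1n mulrDl mul1r mulrDr mulr1 mulrACA.
    by rewrite ee mul0r addr0 mulrDr -addrA [e * _ + _ in LHS]addrC.
  exact: H.
have [i si] : exists i, s i != i.
  apply/existsP; apply: contraNT s1 => /existsPn h; apply/eqP/permP=> i.
  by rewrite perm1; have /negPn/eqP := h i.
have ssi : s (s i) != s i by rewrite (inj_eq perm_inj).
rewrite (bigD1 i) //= (bigD1 (s i)) //=.
have off (a b : 'I_n) : b != a -> (1%:M + e *: T) a b = e * T a b.
  by move=> /negbTE ba; rewrite !mxE eq_sym ba mulr0n add0r.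
by rewrite !off // (mulrA (e * _)) mulrACA ee !mul0r mulr0.
Qed.

(** * The finite local ring and its characters *)

Section CharacterSums.
Variables (V : finZmodType) (f : V -> algC).
Hypothesis fD : forall a b, f (a + b) = f a * f b.

Lemma sum_addchar : (exists a, f a != 1) -> \sum_a f a = 0.
Proof.
case=> a fa; apply/eqP; have : (f a - 1) * \sum_b f b == 0.
  rewrite mulrBl mul1r subr_eq0 mulr_sumr [X in _ == X](reindex_inj (addrI a)).
  by apply/eqP/eq_bigr => b _; rewrite fD.
by rewrite mulf_eq0 subr_eq0 (negbTE fa).
Qed.
End CharacterSums.

Section LocalRing.
Variables (R : finComUnitRingType) (k : finFieldType) (red : {rmorphism R -> k}).
Variables (w : R) (l : nat).
Hypotheses (wl0 : w ^+ l = 0) (wl1 : w ^+ l.-1 != 0).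
Hypothesis red_surj : forall a : k, exists b : R, red b = a.
Hypothesis red_ker : forall a : R, red a = 0 <-> exists b : R, a = w * b.

Lemma w_exp0 j : (l <= j)%N -> w ^+ j = 0.
Proof. by move=> lj; rewrite -(subnK lj) exprD wl0 mulr0. Qed.

Lemma unit_sub_nilpotent (S : unitRingType) (x : S) j :
  x ^+ j = 0 -> 1 - x \is a GRing.unit.
Proof.
move=> xj; apply/unitrP; exists (\sum_(i < j) x ^+ i).
have e1 : (1 - x) * (\sum_(i < j) x ^+ i) = 1.
  by have := subrX1 x j; rewrite xj sub0r => /esym e; rewrite -[1 - x]opprB mulNr e opprK.
split => //; rewrite -[RHS]e1 mulr_suml mulr_sumr; apply: eq_bigr => i _.
by rewrite mulrBl mulrBr mul1r mulr1 -exprS -exprSr.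
Qed.

(** With b lifting the inverse of [red a], the product a b differs from 1 by a multiple of the
    nilpotent w. *)
Lemma red_unit a : red a != 0 -> a \is a GRing.unit.
Proof.
move=> ra; have [b rb] := red_surj (red a)^-1.
have /red_ker[c ec] : red (1 - a * b) = 0.
  by rewrite rmorphB rmorph1 rmorphM rb divff // subrr.
have : a * b \is a GRing.unit.
  have -> : a * b = 1 - w * c by rewrite -ec opprB addrC subrK.
  by apply: (@unit_sub_nilpotent _ _ l); rewrite exprMn wl0 mul0r.
by rewrite unitrM => /andP[].
Qed.

Lemma w_ann m a : (m <= l)%N -> w ^+ m * a = 0 -> exists b, a = w ^+ (l - m) * b.
Proof.
move=> ml wa; suff H j : (j <= l - m)%N -> exists b, a = w ^+ j * b by apply: H.
elim: j => [|j IH] jl; first by exists a; rewrite mul1r.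
have [b eb] := IH (ltnW jl).
have [/red_ker[c ec]|rb] := eqVneq (red b) 0.
  by exists c; rewrite exprSr -mulrA -ec.
have : w ^+ (m + j) = 0.
  by apply: (mulIr (red_unit rb)); rewrite mul0r exprD -mulrA -eb.
move=> wmj; case/eqP: wl1; rewrite (_ : l.-1 = m + j + (l.-1 - (m + j)))%N.
  by rewrite exprD wmj mul0r.
by lia.
Qed.

(** A nonzero [a] is a power of w times a unit, so every nonzero ideal contains w^(l-1). *)
Lemma w_socle a : a != 0 -> exists c, a * c = w ^+ l.-1.
Proof.
move=> a0; suff H j : (j <= l)%N ->
    (exists c, a * c = w ^+ l.-1) \/ exists b, a = w ^+ j * b.
  by have [//|[b eb]] := H l (leqnn l); rewrite eb wl0 mul0r eqxx in a0.
elim: j => [|j IH] jl; first by right; exists a; rewrite mul1r.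
have [|[b eb]] := IH (ltnW jl); first by left.
have [/red_ker[c ec]|rb] := eqVneq (red b) 0.
  by right; exists c; rewrite exprSr -mulrA -ec.
left; exists (b^-1 * w ^+ (l.-1 - j)).
rewrite eb mulrA mulrK ?red_unit // -exprD; congr (_ ^+ _).
by lia.
Qed.

Section AddChar.
Variables (phi : R -> algC).
Hypothesis phi_prim : primitive_char w l phi.

Lemma addchar_add a b : phi (a + b) = phi a * phi b.
Proof. by case: phi_prim => -[]. Qed.

Lemma addchar_0 : phi 0 = 1.
Proof. by case: phi_prim => -[]. Qed.

Lemma addchar_neq0 a : phi a != 0.
Proof.
apply/eqP=> e; have := addchar_add a (- a).
by rewrite subrr addchar_0 e mul0r => /eqP; rewrite oner_eq0.
Qed.

Lemma addchar_opp a : phi (- a) = (phi a)^-1.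
Proof.
apply: (mulfI (addchar_neq0 a)); rewrite -addchar_add subrr addchar_0.
by rewrite divff ?addchar_neq0.
Qed.

(** If a were nonzero, the ideal it generates would contain w^(l-1) R, on which [phi] is
    nontrivial. *)
Lemma addchar_nondegenerate a : (forall b, phi (a * b) = 1) -> a = 0.
Proof.
move=> H; apply/eqP/negP=> /negP/w_socle[c ec].
by case: phi_prim => _ [b]; rewrite -ec -mulrA H eqxx.
Qed.

Variable n : nat.
Implicit Types (A B X Y Z g u v : 'M[R]_n.+1).

Definition psi A := phi (\tr A).

Lemma psiD A B : psi (A + B) = psi A * psi B.
Proof. by rewrite /psi mxtraceD addchar_add. Qed.

Lemma psi0 : psi 0 = 1.
Proof. by rewrite /psi mxtrace0 addchar_0. Qed.

Lemma psi_neq0 A : psi A != 0.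
Proof. exact: addchar_neq0. Qed.

Lemma psiN A : psi (- A) = (psi A)^-1.
Proof. by rewrite /psi raddfN addchar_opp. Qed.

Lemma psiC A B : psi (A * B) = psi (B * A).
Proof. by rewrite /psi trace_mulC. Qed.

Lemma psiZC a A B : psi (a *: (A * B)) = psi (a *: (B * A)).
Proof. by rewrite scalerAl psiC -scalerAr. Qed.

Lemma psi_star A : psi (star A) = psi A.
Proof. by rewrite /psi star_trace. Qed.

Lemma psi_mul_delta A b (i j : 'I_n.+1) :
  psi (A * (b *: delta_mx j i)) = phi (A i j * b).
Proof. by rewrite /psi -scalerAr mxtraceZ trace_mul_delta mulrC. Qed.

Lemma sum_psi A : A != 0 -> \sum_Y psi (A * Y) = 0.
Proof.
move=> A0; apply: (@sum_addchar _ (fun Y => psi (A * Y))) => [Y Z|].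
  by rewrite mulrDr psiD.
have /existsP[Y hY] : [exists Y : 'M[R]_n.+1, psi (A * Y) != 1].
  apply: contraT => /existsPn H; case/eqP: A0; apply/matrixP=> i j.
  rewrite [RHS]mxE; apply: addchar_nondegenerate => b.
  by have /negPn/eqP := H (b *: delta_mx j i); rewrite psi_mul_delta.
by exists Y.
Qed.

Definition shift : 'M[R]_n.+1 := \matrix_(i, j) (i == j.+1 :> nat)%:R.
(** The trace against [shift] adds up the superdiagonal entries, so this is [phi] of their sum. *)
Definition theta0 u := psi (shift * (u - 1)).

Lemma hess_trace X Z : hess X -> strict_upper Z -> \tr (X * Z) = \tr (shift * Z).
Proof.
move=> hX hZ; rewrite /mxtrace -!mulmxE; apply: eq_bigr => i _; rewrite !mxE.
apply: eq_bigr => j _; have [ij|ji] := leqP i j.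
  by rewrite hZ // !mulr0.
by rewrite hX // mxE.
Qed.

Lemma theta0_strict X Z : hess X -> strict_upper Z -> theta0 (1 + Z) = psi (X * Z).
Proof. by move=> hX hZ; rewrite /theta0 addrC addKr /psi (hess_trace hX). Qed.

Lemma shift_hess : hess shift.
Proof. by move=> i j ji; rewrite mxE. Qed.

(** The product (u - 1)(v - 1) has zero superdiagonal. *)
Lemma theta0_mul u v : unipotent u -> unipotent v ->
  theta0 (u * v) = theta0 u * theta0 v.
Proof.
move=> hu hv; rewrite /theta0 -psiD -mulrDr.
have -> : u * v - 1 = (u - 1) * (v - 1) + ((u - 1) + (v - 1)).
  rewrite mulrBl mul1r mulrBr mulr1 [(u - 1) + _]addrC addrA subrK.
  by rewrite addrA subrK.
have := psiD (shift * ((u - 1) * (v - 1))) (shift * (u - 1 + (v - 1))).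
rewrite -mulrDr => ->.
suff -> : psi (shift * ((u - 1) * (v - 1))) = 1 by rewrite mul1r.
rewrite /psi (_ : \tr _ = 0) ?addchar_0 //.
rewrite /mxtrace big1 // => i _; rewrite -!mulmxE mxE big1 // => j _; rewrite mxE.
have [e|_] := eqVneq (i : nat) j.+1; last by rewrite mul0r.
rewrite mul1r mxE big1 // => s _; have [sj|js] := leqP s j.
  by rewrite hu ?mul0r.
by rewrite hv ?mulr0 // e.
Qed.

Lemma theta0_star u : theta0 (star u) = theta0 u.
Proof.
rewrite /theta0; have -> : star u - 1 = star (u - 1).
  by rewrite starD -scaleN1r starZ star1 scaleN1r.
have es : star shift = shift.
  apply/matrixP=> i j; rewrite !mxE; congr (nat_of_bool _)%:R => /=.
  by have := ltn_ord i; have := ltn_ord j; lia.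
by rewrite -{1}es -starM psi_star psiC.
Qed.

Lemma theta0_neq0 u : theta0 u != 0.
Proof. exact: psi_neq0. Qed.

Lemma unit_1w j A : (0 < j)%N -> 1 + w ^+ j *: A \is a GRing.unit.
Proof.
move=> j0; rewrite -[w ^+ j *: A]opprK; apply: (@unit_sub_nilpotent _ _ l).
rewrite -scalerN exprZn -exprM w_exp0 ?scale0r //.
by rewrite -{1}[l]mul1n leq_mul2r j0 orbT.
Qed.

Lemma conj_1w g a A : g \is a GRing.unit ->
  g * (1 + a *: (g^-1 * A * g)) = (1 + a *: A) * g.
Proof.
move=> ug; rewrite mulrDr mulrDl mul1r mulr1 -scalerAl -scalerAr !mulrA.
by rewrite mulrV // mul1r.
Qed.

Lemma conj_1wV g a A : g \is a GRing.unit ->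
  g * (1 + a *: A) = (1 + a *: (g * A * g^-1)) * g.
Proof.
by move=> ug; rewrite mulrDr mulrDl mul1r mulr1 -scalerAl -scalerAr mulrVK.
Qed.

Lemma scale_cong m A B : (m <= l)%N -> w ^+ m *: A = w ^+ m *: B ->
  exists E, A = B + w ^+ (l - m) *: E.
Proof.
move=> ml e; have H i j : {b : R | A i j - B i j = w ^+ (l - m) * b}.
  have /sigW : exists b, A i j - B i j == w ^+ (l - m) * b.
    have [|b eb] := @w_ann m (A i j - B i j) ml.
      have := congr1 (fun M : 'M_n.+1 => M i j) e; rewrite !mxE mulrBr => ->.
      by rewrite subrr.
    by exists b; apply/eqP.
  by case=> b /eqP eb; exists b.
exists (\matrix_(i, j) sval (H i j)); apply/matrixP=> i j.
by rewrite !mxE -(svalP (H i j)) addrC subrK.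
Qed.

Lemma lift_mx (V : 'M[k]_n.+1) :
  exists2 A, map_mx red A = V & (strict_upper V -> strict_upper A).
Proof.
have H a : {b : R | red b = a /\ (a = 0 -> b = 0)}.
  have [->|a0] := eqVneq a 0; first by exists 0; rewrite rmorph0.
  have /sigW[b /eqP eb] : exists b, red b == a.
    by have [b <-] := red_surj a; exists b.
  by exists b; split=> // e; rewrite e eqxx in a0.
exists (\matrix_(i, j) sval (H (V i j))).
  by apply/matrixP=> i j; rewrite !mxE; case: (H _) => b [].
by move=> hV i j ji; rewrite mxE; have [_] := svalP (H (V i j)); apply; apply: hV.
Qed.

Lemma red_mx_cong A B : map_mx red A = map_mx red B -> exists Z, A = B + w *: Z.
Proof.
move=> e; have H i j : {b : R | A i j - B i j = w * b}.
  have /sigW[b /eqP eb] : exists b, A i j - B i j == w * b.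
    have /red_ker[b eb] : red (A i j - B i j) = 0.
      have := congr1 (fun M : 'M_n.+1 => M i j) e; rewrite !mxE rmorphB => ->.
      by rewrite subrr.
    by exists b; apply/eqP.
  by exists b.
exists (\matrix_(i, j) sval (H i j)); apply/matrixP=> i j.
by rewrite !mxE -(svalP (H i j)) addrC subrK.
Qed.

(** * Functions equivariant under U on both sides *)

Section Gelfand.
Hypothesis l_ge2 : (2 <= l)%N.
Hypothesis two_k : (2%:R : k) != 0.
Variable h : 'M[R]_n.+1 -> algC.
Hypothesis hl : forall u g, unipotent u -> h (u * g) = theta0 u * h g.
Hypothesis hr : forall u g, unipotent u -> h (g * u) = theta0 u * h g.
Hypothesis hs : forall g, h (star g) = - h g.

(** With m = ceil(l/2) and m' = floor(l/2), the group 1 + w^m M_n is abelian and its characters have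
    parameters modulo w^m'. *)
Let m := uphalf l.
Let m' := l./2.
Let mm : (m' + m = l)%N. Proof. by rewrite /m /m'; lia. Qed.
Let m'm : (m' <= m)%N. Proof. by rewrite /m /m'; lia. Qed.
Let m'0 : (0 < m')%N. Proof. by rewrite /m'; lia. Qed.
Let ml : (m <= l)%N. Proof. by rewrite -mm leq_addl. Qed.
Let lm : (l - m = m')%N. Proof. by rewrite -mm addnK. Qed.

Let wmm : w ^+ (m + m) = 0.
Proof. by apply: w_exp0; have := mm; have := m'm; lia. Qed.

(* Congruence of matrices modulo w^(l - m). *)
Definition congm A B := w ^+ m *: A = w ^+ m *: B.

Lemma congm_mull C A B : congm A B -> congm (C * A) (C * B).
Proof. by move=> e; rewrite /congm !scalerAr e. Qed.

Lemma congm_mulr C A B : congm A B -> congm (A * C) (B * C).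
Proof. by move=> e; rewrite /congm !scalerAl e. Qed.

Lemma congm_1w A : congm (1 + w ^+ m' *: A) 1.
Proof. by rewrite /congm scalerDr scalerA -exprD addnC mm wl0 scale0r addr0. Qed.

Lemma congm_conj g A B : g \is a GRing.unit -> congm (g * A) (B * g) ->
  congm (g * A * g^-1) B.
Proof. by move=> ug /(congm_mulr g^-1); rewrite mulrK. Qed.

Lemma congm_conj1w u A : unipotent u -> congm u 1 -> congm (u * A * u^-1) A.
Proof.
move=> hu e; apply: congm_conj; first exact: unipotent_unit.
by rewrite /congm (congm_mulr A e) (congm_mull A e) mul1r mulr1.
Qed.

Lemma psi_congm_conj g Y A : g \is a GRing.unit -> congm (g * Y) (Y * g) ->
  psi (w ^+ m *: (Y * (g^-1 * A * g))) = psi (w ^+ m *: (Y * A)).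
Proof.
move=> ug /(congm_conj ug) e; rewrite psiZC -!mulrA psiZC -!mulrA scalerAr.
by rewrite mulrA e -scalerAr psiZC.
Qed.

(* The component of h, as a function on the coset of the abelian group
   1 + w^m M_n through g, at the character of parameter X. *)
Definition fourier X g := \sum_Y h (g * (1 + w ^+ m *: Y)) * psi (- (w ^+ m *: (X * Y))).

Lemma fourier_cong X X' g : congm X X' -> fourier X g = fourier X' g.
Proof.
by move=> e; apply: eq_bigr => Y _; rewrite /congm in e; rewrite !scalerAl e.
Qed.

Lemma fourier_mulr X g Z :
  fourier X (g * (1 + w ^+ m *: Z)) = psi (w ^+ m *: (X * Z)) * fourier X g.
Proof.
rewrite /fourier mulr_sumr [RHS](reindex_inj (addrI Z)) /=; apply: eq_bigr => Y _.
rewrite -mulrA; have -> : (1 + w ^+ m *: Z) * (1 + w ^+ m *: Y) = 1 + w ^+ m *: (Z + Y).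
  rewrite mulrDl mul1r mulrDr mulr1 -scalerAl -scalerAr scalerA -exprD.
  by rewrite wmm scale0r addr0 scalerDr -addrA [w ^+ m *: Y + _]addrC.
rewrite mulrCA; congr (_ * _).
by rewrite mulrDr scalerDr opprD psiD mulrA -psiD subrr psi0 mul1r.
Qed.

Lemma fourier_unil X u g : unipotent u -> fourier X (u * g) = theta0 u * fourier X g.
Proof.
move=> hu; rewrite /fourier mulr_sumr; apply: eq_bigr => Y _.
by rewrite -mulrA hl // mulrA.
Qed.

(** Moving u past 1 + w^m Y conjugates Y, and dually the parameter X. *)
Lemma fourier_unir X u g : unipotent u ->
  fourier X (g * u) = theta0 u * fourier (u * X * u^-1) g.
Proof.
move=> hu; have uu := unipotent_unit hu; rewrite /fourier mulr_sumr.
rewrite [RHS](reindex (fun Y => u * Y * u^-1)) /=; last first.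
  exists (fun Y => u^-1 * Y * u) => Y _; rewrite !mulrA.
    by rewrite mulVr // mul1r mulrVK.
  by rewrite mulrV // mul1r mulrK.
apply: eq_bigr => Y _; rewrite mulrA -hr //; congr (h _ * _).
  rewrite -!mulrA; congr (_ * _); rewrite mulrDl mul1r mulrDr mulr1.
  by rewrite -scalerAl -scalerAr -!mulrA mulVr // mulr1.
rewrite !psiN; congr (_^-1).
by rewrite !mulrA mulrVK // [in RHS]psiZC -!mulrA mulKr.
Qed.

Lemma fourier_inversion g : (forall X, fourier X g = 0) -> h g = 0.
Proof.
move=> H; have : \sum_X fourier X g = 0 by apply: big1.
(* Summing the characters over X leaves the Y with w^m Y = 0. There may be several, as Y runs over
   M_n(R) rather than a quotient, but each contributes the same positive multiple of [h g]. *)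
rewrite exchange_big /= (eq_bigr (fun Y => (w ^+ m *: Y == 0)%:R * (h g * #|{: 'M[R]_n.+1}|%:R))).
  rewrite -mulr_suml => /eqP; rewrite mulf_eq0 => /orP[|].
    rewrite (bigD1 0) //= scaler0 eqxx paddr_eq0 ?ler01 ?oner_eq0 //.
    by apply: sumr_ge0 => Y _; apply: ler0n.
  rewrite mulf_eq0 => /orP[/eqP //|].
  by rewrite pnatr_eq0 (cardD1 0) inE.
move=> Y _; have [wY|wY] := eqVneq (w ^+ m *: Y) 0.
  rewrite mul1r wY (eq_bigr (fun=> h g)) => [|X _].
    by rewrite sumr_const mulr_natr.
  by rewrite scalerAr wY mulr0 oppr0 psi0 mulr1 addr0 mulr1.
rewrite mul0r -mulr_sumr (eq_bigr (fun X => psi (- (w ^+ m *: Y) * X))).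
  by rewrite sum_psi ?mulr0 // oppr_eq0.
by move=> X _; rewrite scalerAr -mulrN psiC.
Qed.

(** [sigma Y] is [star] between mutually inverse unipotent factors, whose [theta0] values cancel, so
    h changes sign under it. Since g commutes with Y up to congruence, the parameter survives the
    reindexing. *)
Lemma fourier_sigma Y g : hess Y -> g \is a GRing.unit -> congm (g * Y) (Y * g) ->
  fourier Y (sigma Y g) = - fourier Y g.
Proof.
move=> hY ug cg; have hsig A : h (sigma Y A) = - h A.
  rewrite /sigma hr; last exact: star_conj_unipotent.
  rewrite hl; last exact/unipotentV/star_conj_unipotent.
  rewrite hs mulrA; have -> : theta0 (star_conj Y) * theta0 (star_conj Y)^-1 = 1.
    rewrite -theta0_mul; [|exact: star_conj_unipotent|exact/unipotentV/star_conj_unipotent].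
    rewrite mulrV; last exact/unipotent_unit/star_conj_unipotent.
    by rewrite /theta0 subrr mulr0 psi0.
  by rewrite mul1r.
rewrite /fourier -sumrN (reindex (fun Z => sigma Y (g * Z * g^-1))) /=; last first.
  exists (fun Z => g^-1 * sigma Y Z * g) => Z _.
    by rewrite sigmaK // -!mulrA mulVr // mulr1 mulKr.
  by rewrite mulrA mulVKr // mulrK // sigmaK.
apply: eq_bigr => Z _; rewrite -mulNr -hsig; congr (h _ * _).
  rewrite -sigmaZ -(sigma1 hY) -sigmaD -!sigmaM // sigma1 //; congr (sigma _ _).
  by rewrite mulrDl mulrDr mul1r mulr1 -scalerAl mulrVK // -scalerAr.
rewrite !psiN; congr (_^-1).
have -> : psi (w ^+ m *: (Y * sigma Y (g * Z * g^-1))) = psi (w ^+ m *: (g * Z * g^-1 * Y)).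
  rewrite -{1}(sigma_fix hY) -sigmaM // -sigmaZ /psi sigma_trace //.
have e : congm (g^-1 * Y * g) Y.
  by rewrite -mulrA -{2}[Y](mulKr ug); apply/congm_mull.
by rewrite -mulrA psiZC !mulrA scalerAl e -scalerAl.
Qed.

(** Testing on multiples of elementary matrices, nondegeneracy of [phi] determines the entries of X
    below the diagonal up to congruence. *)
Lemma hess_of_psi X :
  (forall Z, strict_upper Z -> psi (w ^+ m *: (X * Z)) = psi (w ^+ m *: (shift * Z))) ->
  exists2 X', hess X' & congm X X'.
Proof.
move=> H; exists (\matrix_(i, j) if (j < i)%N then shift i j else X i j).
  by move=> i j ji; rewrite !mxE ji.
apply/matrixP=> i j; rewrite !mxE; case: ifP => // ji.
apply/eqP; rewrite -subr_eq0 -mulrBr; apply/eqP/addchar_nondegenerate => b.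
have sZ : strict_upper (b *: delta_mx j i : 'M[R]_n.+1).
  move=> a c ca; rewrite !mxE; case: eqP => [ea|]; last by rewrite mulr0.
  case: eqP => [ec|]; last by rewrite mulr0.
  by move: ca ji; rewrite ea ec leqNgt => /negbTE->.
have := H _ sZ; rewrite !scalerAl !psi_mul_delta !mxE => e.
by rewrite mulrBr mulrBl addchar_add addchar_opp e divff // addchar_neq0.
Qed.

Lemma theta0_1w Z j : strict_upper Z -> theta0 (1 + w ^+ j *: Z) = psi (w ^+ j *: (shift * Z)).
Proof.
move=> hZ; rewrite (theta0_strict shift_hess); last exact: strict_upperZ.
by rewrite -scalerAr.
Qed.

Lemma congm_1wm A : congm (1 + w ^+ m *: A) 1.
Proof.
by rewrite /congm scalerDr scalerA -exprD wmm scale0r addr0.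
Qed.

(** For strictly upper Z, the element 1 + w^m Z lies both in U and in the congruence subgroup; the
    two equivariance laws must agree. *)
Lemma hess_right X g : fourier X g != 0 -> exists2 X', hess X' & congm X X'.
Proof.
move=> H0; apply: hess_of_psi => Z hZ; apply: (mulIf H0).
have hu : unipotent (1 + w ^+ m *: Z) by apply/unipotent_strict/strict_upperZ.
rewrite -fourier_mulr -theta0_1w // fourier_unir //; congr (_ * _).
by apply: fourier_cong; apply: congm_conj1w => //; apply: congm_1wm.
Qed.

Lemma hess_left X g : g \is a GRing.unit -> fourier X g != 0 ->
  exists2 Y, hess Y & congm (g * X * g^-1) Y.
Proof.
move=> ug H0; apply: hess_of_psi => Z hZ; apply: (mulIf H0).
rewrite -theta0_1w // -fourier_unil; last exact/unipotent_strict/strict_upperZ.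
have -> : (1 + w ^+ m *: Z) * g = g * (1 + w ^+ m *: (g^-1 * Z * g)).
  by rewrite mulrDl mulrDr mul1r mulr1 -scalerAl -scalerAr !mulrA mulrV // mul1r.
rewrite fourier_mulr; congr (_ * _).
by rewrite [in RHS]psiZC -!mulrA psiZC -!mulrA -psiZC -!mulrA.
Qed.

Lemma fourier_sigma_fixed Y g : hess Y -> g \is a GRing.unit ->
  congm (g * Y) (Y * g) -> sigma Y g = g -> fourier Y g = 0.
Proof.
move=> hY ug cg sg; have := fourier_sigma hY ug cg; rewrite sg => /eqP.
by rewrite -addr_eq0 -mulr2n mulrn_eq0 => /eqP.
Qed.

(** * The case l = 2m' + 1 *)

Section Odd.
Hypothesis m_odd : m = m'.+1.
Variables Y c : 'M[R]_n.+1.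
Hypotheses (hY : hess Y) (cY : c * Y = Y * c) (uc : c \is a GRing.unit).

Let w3 : w ^+ (m' + m') * w ^+ m' = 0.
Proof.
by rewrite -exprD w_exp0 // -mm m_odd -addnA leq_add2l -add1n leq_add2r.
Qed.

Lemma conj_psi j A : psi (w ^+ j *: (Y * (c * A * c^-1))) = psi (w ^+ j *: (Y * A)).
Proof.
by rewrite !mulrA -cY -!mulrA psiZC -!mulrA mulVr // mulr1.
Qed.

(* Compare the two ways of moving 1 + w^m' v out of the argument: directly to
   the right, or to the left through c (1 + w^m' kap). *)
Lemma fourier_commutator kap v v' z :
  fourier Y (c * (1 + w ^+ m' *: kap)) != 0 ->
  strict_upper v -> strict_upper v' -> c * v * c^-1 = v' + w *: z ->
  psi (w ^+ (m' + m') *: (Y * (kap * v - v * kap))) = 1.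
Proof.
set k1 := 1 + w ^+ m' *: kap => H0 hv hv' ev.
pose u := 1 + w ^+ m' *: v; pose u' := 1 + w ^+ m' *: v'.
have hu : unipotent u by apply/unipotent_strict/strict_upperZ.
have hu' : unipotent u' by apply/unipotent_strict/strict_upperZ.
have uk1 : k1 \is a GRing.unit by apply: unit_1w.
have uu := unipotent_unit hu.
have uuk : u * k1 \is a GRing.unit by rewrite unitrMl.
have uck : c * k1 \is a GRing.unit by rewrite unitrMl.
have way1 : fourier Y (c * k1 * u) = theta0 u * fourier Y (c * k1).
  rewrite fourier_unir //; congr (_ * _); apply: fourier_cong.
  by apply: congm_conj1w => //; apply: congm_1w.
(* As m = m' + 1, the commutator term w^(2m') K is w^m w^(m'-1) K, hence of congruence level m. *)
pose K := kap * v - v * kap; pose D := w ^+ m'.-1 *: ((u * k1)^-1 * K).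
have wD : w ^+ m *: D = w ^+ (m' + m') *: ((u * k1)^-1 * K).
  by rewrite /D scalerA -exprD; rewrite m_odd addSnnS prednK.
have comm_uk : k1 * u = u * k1 * (1 + w ^+ m *: D).
  rewrite wD [RHS]mulrDr mulr1 -[u * k1 * (_ *: _)]scalerAr (mulVKr uuk) /k1 /u /K.
  rewrite !mulrDl !mulrDr !mul1r !mulr1 -!scalerAl -!scalerAr !scalerA -!exprD.
  rewrite scalerBr -!addrA; congr (_ + _).
  rewrite [RHS]addrCA; congr (_ + _); congr (_ + _).
  by rewrite addrC subrK.
have way2 : fourier Y (c * k1 * u) =
    psi (w ^+ (m' + m') *: (Y * K)) * fourier Y (c * u * k1).
  rewrite -mulrA comm_uk !mulrA fourier_mulr; congr (psi _ * _).
  rewrite !scalerAr wD; congr (_ * _).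
  (* [u * k1] is 1 modulo w^m', and w^(3m') = 0 because m' is at least 1. *)
  have e : w ^+ (m' + m') *: (u * k1)^-1 = w ^+ (m' + m') *: 1.
    apply: (mulIr uuk); rewrite -!scalerAl mulVr // mul1r /u /k1.
    rewrite mulrDl mul1r mulrDr mulr1 -!scalerAl -scalerAr !scalerDr !scalerA.
    by rewrite w3 mul0r !scale0r !addr0.
  by rewrite scalerAl e -scalerAl mul1r.
(* Conjugating u by c gives the unipotent u' up to a factor 1 + w^m z, whose value compensates for
   the difference between [theta0 u'] and [theta0 u]. *)
have way3 : fourier Y (c * u * k1) = theta0 u * fourier Y (c * k1).
  have -> : c * u * k1 = u' * ((c * k1) * (1 + w ^+ m *: ((c * k1)^-1 * z * (c * k1)))).
    rewrite conj_1w // -[c * u * k1]/(c * (1 + w ^+ m' *: v) * k1) conj_1wV // !mulrA.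
    congr (_ * k1).
    congr (_ * c); rewrite ev /u' mulrDr mulr1 mulrDl mul1r -!scalerAl -scalerAr.
    rewrite [w ^+ m' *: (w ^+ m *: _)]scalerA -exprD mm wl0 scale0r addr0.
    by rewrite scalerDr scalerA -exprSr -m_odd addrA.
  rewrite (fourier_unil Y _ hu') fourier_mulr mulrA; congr (_ * _).
  have -> : psi (w ^+ m *: (Y * ((c * k1)^-1 * z * (c * k1)))) = psi (w ^+ m *: (Y * z)).
    apply: psi_congm_conj => //.
    rewrite mulrA -cY -!mulrA; apply: congm_mull.
    rewrite /congm (congm_mulr Y (congm_1w kap)) (congm_mull Y (congm_1w kap)).
    by rewrite mul1r mulr1.
  rewrite /u' /u !theta0_1w // -psiD.
  have shiftY Z : strict_upper Z -> psi (w ^+ m' *: (shift * Z)) = psi (w ^+ m' *: (Y * Z)).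
    by move=> hZ; rewrite !scalerAr /psi -(hess_trace hY) //; apply: strict_upperZ.
  rewrite shiftY // psiD shiftY // -psiD -(conj_psi m' v) ev.
  by congr psi; rewrite mulrDr scalerDr -scalerAr scalerA -exprSr -m_odd.
have : psi (w ^+ (m' + m') *: (Y * K)) * (theta0 u * fourier Y (c * k1)) =
    1 * (theta0 u * fourier Y (c * k1)).
  by rewrite -{1}way3 -way2 way1 mul1r.
by apply: mulIf; rewrite mulf_neq0 // theta0_neq0.
Qed.

(** If the component were nonzero, [fourier_commutator] would supply the trace condition of
    [sigma_fixed_rep] over the residue field. Then kap can be changed by a unipotent factor and a
    factor of level m until c (1 + w^m' kap) is fixed by [sigma Y], where the component vanishes. *)
Lemma fourier_odd_eq0 kap : fourier Y (c * (1 + w ^+ m' *: kap)) = 0.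
Proof.
apply/eqP; apply: contraT => H0.
have fc : map_mx red c \is a GRing.unit by apply: (rmorph_unit (map_mx red)).
have cYf : map_mx red c * map_mx red Y = map_mx red Y * map_mx red c by rewrite -!rmorphM /= cY.
have [|v0 sv0 ev0] := sigma_fixed_rep (kap := map_mx red kap) two_k (map_hess red hY) cYf fc.
  move=> v0 sv0 scv0.
  have [v ev /(_ sv0) sv] := lift_mx v0.
  have [v' ev' /(_ scv0) sv'] := lift_mx (map_mx red c * v0 * (map_mx red c)^-1).
  have [|z ez] := @red_mx_cong (c * v * c^-1) v'.
    by rewrite ev' -ev !rmorphM /= rmorphV.
  pose t := \tr (Y * (kap * v - v * kap)).
  have -> : \tr (map_mx red Y * (map_mx red kap * v0 - v0 * map_mx red kap)) = red t.
    by rewrite -trace_map_mx rmorphM rmorphB !rmorphM /= ev.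
  (* Replacing v by all multiples b v upgrades a statement about [phi] to one about its argument. *)
  have wt : w ^+ l.-1 * t = 0.
    apply: addchar_nondegenerate => b.
    have ebz : c * (b *: v) * c^-1 = b *: v' + w *: (b *: z).
      by rewrite -scalerAr -scalerAl ez scalerDr !scalerA mulrC.
    have := fourier_commutator H0 (strict_upperZ _ sv) (strict_upperZ _ sv') ebz.
    rewrite -scalerAr -scalerAl -scalerBr -scalerAr scalerA /psi mxtraceZ -/t.
    have -> : l.-1 = (m' + m')%N by rewrite -mm m_odd addnS.
    by rewrite mulrAC.
  apply/eqP; apply: contraT => /red_unit ut; case/eqP: wl1.
  by apply: (mulIr ut); rewrite mul0r.
have [v ev /(_ sv0) sv] := lift_mx v0.
have u2 : (2%:R : R) \is a GRing.unit by apply: red_unit; rewrite rmorph_nat.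
pose tau A := c^-1 * sigma Y A * c.
have sc : sigma Y c = c by apply: sigma_comm.
have scV : sigma Y c^-1 = c^-1.
  apply: sigma_comm => //.
  by apply: (mulrI uc); rewrite mulVKr // mulrA cY -mulrA mulrV // mulr1.
have tauK A : tau (tau A) = A.
  rewrite /tau (sigmaM hY _ c) (sigmaM hY c^-1) sc scV sigmaK //.
  by rewrite mulKr // -mulrA mulVr ?mulr1.
(* Averaging over the involution [tau], possible since 2 is a unit, makes the residual invariance
   exact over R. *)
pose kap1 := kap - v; pose kap0 := (2%:R : R)^-1 *: (kap1 + tau kap1).
have tau0 : tau kap0 = kap0.
  rewrite /tau /kap0 sigmaZ -scalerAr -scalerAl sigmaD mulrDr mulrDl.
  by rewrite -/(tau kap1) -/(tau (tau kap1)) tauK addrC.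
have [|z ez] := @red_mx_cong kap1 kap0.
  have etau A : map_mx red (tau A) =
      (map_mx red c)^-1 * sigma (map_mx red Y) (map_mx red A) * map_mx red c.
    rewrite /tau -map_sigma //; move: (sigma Y A) => B.
    by rewrite !rmorphM /= rmorphV.
  have ekap1 : map_mx red kap1 = map_mx red kap - v0 by rewrite /kap1 rmorphB /= ev.
  rewrite /kap0 map_mxZ (map_mxD red kap1) etau ekap1 ev0 -mulr2n -scaler_nat scalerA rmorphV // rmorph_nat.
  by rewrite mulVf // scale1r.
clearbody kap0; pose k0 := 1 + w ^+ m' *: kap0; pose u := 1 + w ^+ m' *: v.
have hu : unipotent u by apply/unipotent_strict/strict_upperZ.
have uk0 : k0 \is a GRing.unit by apply: unit_1w.
have uu := unipotent_unit hu.
have uA : k0 * u \is a GRing.unit by rewrite unitrMl.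
(* [z] corrects the lift modulo w, and the second term cancels the cross term w^(2m') kap0 v of k0
   u. *)
pose Z := (k0 * u)^-1 * (z - w ^+ m'.-1 *: (kap0 * v)).
have ek : 1 + w ^+ m' *: kap = k0 * u * (1 + w ^+ m *: Z).
  rewrite [RHS]mulrDr mulr1 -[k0 * u * (_ *: _)]scalerAr (mulVKr uA).
  have -> : kap = kap0 + w *: z + v by rewrite -ez /kap1 subrK.
  rewrite /k0 /u mulrDl mul1r mulrDr mulr1 -scalerAl -scalerAr.
  rewrite scalerBr !scalerDr !scalerA -!exprD -exprSr -m_odd.
  have -> : (m + m'.-1 = m' + m')%N by rewrite m_odd addSnnS prednK.
  move: (w ^+ (m' + m') *: (kap0 * v)) => d.
  rewrite -!addrA [d + (_ - d)]addrC subrK; congr (_ + _).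
  by rewrite addrA addrC.
case/eqP: H0; rewrite ek !mulrA fourier_mulr fourier_unir //.
rewrite (@fourier_cong _ Y); last by apply: congm_conj1w => //; apply: congm_1w.
rewrite fourier_sigma_fixed ?mulr0 //.
- by rewrite unitrMl.
- rewrite mulrA -cY -!mulrA; apply: congm_mull.
  rewrite /congm (congm_mulr Y (congm_1w kap0)) (congm_mull Y (congm_1w kap0)).
  by rewrite mul1r mulr1.
rewrite sigmaM // sc /k0 sigmaD sigma1 // sigmaZ.
have -> : sigma Y kap0 = c * kap0 * c^-1.
  rewrite -{2}tau0 /tau; move: (sigma Y kap0) => B.
  by rewrite !mulrA mulrV // mul1r mulrK.
by rewrite -conj_1wV.
Qed.
End Odd.

(** For even l, m = m' and the factor with kap lies in the congruence subgroup, leaving c, which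
    [sigma Y] fixes. *)
Lemma fourier_ck_eq0 Y c kap : hess Y -> c * Y = Y * c -> c \is a GRing.unit ->
  fourier Y (c * (1 + w ^+ m' *: kap)) = 0.
Proof.
move=> hY cY uc; have em : m = (odd l + m')%N by rewrite /m uphalf_half.
case: (odd l) em => em; first exact: fourier_odd_eq0.
have <- : m = m' by [].
rewrite fourier_mulr fourier_sigma_fixed ?mulr0 //; first by rewrite /congm cY.
exact: sigma_comm.
Qed.

(* A nonzero component at X forces X and g X g^-1 to be Hessenberg up to
   congruence; then g is, up to congruence, c u with c in the centralizer of
   Y = g X g^-1 and u unipotent. *)
Lemma gelfand_vanish g : g \is a GRing.unit -> h g = 0.
Proof.
move=> ug; apply: fourier_inversion => X; apply/eqP; apply: contraT => H0.
have [X' hX' eX] := hess_right H0; have [Y hY eY] := hess_left ug H0.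
rewrite (fourier_cong _ eX) in H0.
have gXY : congm (g * X') (Y * g).
  have := congm_mulr g eY; rewrite mulrVK //; apply: etrans.
  by apply: congm_mull; apply: esym.
have [p hp] := hess_poly_col g hY; pose c := horner_mx Y p.
have cY : c * Y = Y * c by apply: (comm_horner_mx p (commr_refl Y)).
have kX := unipotent_unit (hess_krylov hX').
pose u := krylov Y * (krylov X')^-1.
have hu : unipotent u.
  apply: (unipotent_cancelr (hess_krylov hX')).
  by rewrite mulrVK //; apply: hess_krylov.
have gXj j : congm (g * X' ^+ j) (Y ^+ j * g).
  elim: j => [|j IH]; first by rewrite mulr1 mul1r.
  rewrite exprSr mulrA /congm (congm_mulr X' IH) -mulrA exprSr -mulrA.
  exact: congm_mull.
(* Columnwise, g X'^j e_0 is congruent to Y^j g e_0 = Y^j c e_0 = c Y^j e_0, as c and g share their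
   first column. *)
have cgu : congm g (c * u).
  have e : congm (g * krylov X') (c * krylov Y).
    apply/matrixP=> i j; rewrite [LHS]mxE [RHS]mxE !krylov_mul.
    have /matrixP/(_ i ord0) := gXj j; rewrite [LHS]mxE => ->.
    rewrite [LHS]mxE; congr (_ * _).
    have -> : c * Y ^+ j = Y ^+ j * c by apply: intertwine_exp.
    by rewrite -!mulmxE !mxE; apply: eq_bigr => s _; rewrite hp.
  have := congm_mulr (krylov X')^-1 e; rewrite mulrK //.
  by rewrite -mulrA.
have [E eE] := scale_cong ml cgu; rewrite lm in eE.
have uu := unipotent_unit hu.
have uc : c \is a GRing.unit.
  rewrite -(unitrMl _ uu).
  have -> : c * u = g * (1 + w ^+ m' *: (- (g^-1 * E))).
    rewrite mulrDr mulr1 -scalerAr mulrN mulVKr // scalerN {1}eE addrK.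
    by [].
  by rewrite unitrMl // unit_1w.
have eg : g = c * (1 + w ^+ m' *: (c^-1 * E * u^-1)) * u.
  clearbody c u; rewrite mulrDr mulr1 mulrDl -scalerAr -scalerAl !mulrA.
  by rewrite mulrV // mul1r mulrVK.
case/eqP: H0; rewrite eg fourier_unir // (@fourier_cong _ Y).
  by rewrite fourier_ck_eq0 ?mulr0.
apply: congm_conj => //.
have : congm (c * (u * X')) (c * (Y * u)).
  have -> : c * (Y * u) = Y * (c * u) by rewrite mulrA cY -mulrA.
  rewrite [c * (u * X')]mulrA.
  apply: etrans (esym (congm_mulr X' cgu)) _.
  by apply: etrans gXY _; apply: congm_mull.
by move=> /(congm_mull c^-1); rewrite !mulKr.
Qed.
End Gelfand.

Lemma comm_1w a b A B : (l <= a + b)%N ->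
  (1 + w ^+ a *: A) * (1 + w ^+ b *: B) = (1 + w ^+ b *: B) * (1 + w ^+ a *: A).
Proof.
move=> lab; rewrite !mulrDl !mulrDr !mul1r !mulr1 -!scalerAl -!scalerAr !scalerA.
have e : w ^+ a * w ^+ b = 0 by rewrite -exprD w_exp0.
by rewrite e [w ^+ b * _]mulrC e !scale0r !addr0 addrAC.
Qed.

Lemma strict_upper_mulr A B : strict_upper A -> upper B -> strict_upper (A * B).
Proof.
move=> hA hB i j ji; rewrite -mulmxE mxE big1 // => m _.
have [mi|im] := leqP m i; first by rewrite hA ?mul0r.
by rewrite hB ?mulr0 // (leq_ltn_trans ji).
Qed.

Definition strictb A :=
  [forall i : 'I_n.+1, forall j : 'I_n.+1, (j <= i)%N ==> (A i j == 0)].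

Lemma strictbP A : reflect (strict_upper A) (strictb A).
Proof.
apply: (iffP forallP) => [h i j ji|h i]; last first.
  by apply/forallP=> j; apply/implyP=> ji; rewrite h.
by have /forallP/(_ j)/implyP/(_ ji)/eqP := h i.
Qed.

Local Notation gT := {'GL_(n.+1)[R]}.

Definition toGL A : gT := insubd (1%g : gT) A.

Lemma toGLK A : A \is a GRing.unit -> GLval (toGL A) = A.
Proof. by move=> uA; apply: insubdK. Qed.

Lemma GLvalK (g : gT) : toGL (GLval g) = g.
Proof. by apply: val_inj; apply: toGLK; apply: (valP g). Qed.

Lemma toGLM A B : A \is a GRing.unit -> B \is a GRing.unit ->
  toGL (A * B) = (toGL A * toGL B)%g.
Proof.
move=> uA uB; apply: val_inj; rewrite [LHS]toGLK ?unitrMl //.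
by rewrite [RHS]GL_ME !toGLK.
Qed.

(** * Existence of Whittaker vectors *)

Section Descent.
Variables (d : nat) (rho : mx_representation algC [set: gT] d).
Variable X : 'M[R]_n.+1.
Hypothesis hX : hess X.
Hypothesis l_ge2 : (2 <= l)%N.

Let r A := rho (toGL A).

Let rM A B : A \is a GRing.unit -> B \is a GRing.unit -> r (A * B) = r A *m r B.
Proof. by move=> uA uB; rewrite /r toGLM // repr_mxM ?inE. Qed.

Let unipU Z j : strict_upper Z -> 1 + w ^+ j *: Z \is a GRing.unit.
Proof. by move=> hZ; apply/unipotent_unit/unipotent_strict/strict_upperZ. Qed.

(** Modulo w, Y commutes with a Hessenberg matrix and has zero first column, so it vanishes. *)
Lemma descent_centralizer Y : strict_upper Y ->
  w ^+ l.-1 *: (Y * X - X * Y) = 0 -> exists2 Z, strict_upper Z & Y = w *: Z.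
Proof.
move=> hY e; have rY : map_mx red Y = 0.
  apply: (intertwine_eq0 (X := map_mx red X) (Y := map_mx red X)).
  - exact: map_hess.
  - apply/eqP; rewrite -subr_eq0 -!rmorphM -rmorphB /=; apply/eqP/matrixP=> i j.
    rewrite mxE [RHS]mxE; have [|b eb] := @w_ann l.-1 ((Y * X - X * Y) i j) (leq_pred _).
      by have := congr1 (fun M : 'M_n.+1 => M i j) e; rewrite /= mxE => ->; rewrite mxE.
    apply/red_ker; exists b; rewrite eb; congr (_ * _).
    by rewrite (_ : l - l.-1 = 1)%N //; lia.
  by move=> i; rewrite mxE hY ?rmorph0.
have [|Z eZ] := @red_mx_cong Y 0; first by rewrite rY rmorph0.
(* Division by w is not unique, so the quotient is truncated to be strictly upper. *)
exists (\matrix_(i, j) if (j <= i)%N then 0 else Z i j).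
  by move=> i j ji; rewrite mxE ji.
apply/matrixP=> i j; rewrite !mxE; case: ifP => ji; first by rewrite hY ?mulr0.
by rewrite eZ !mxE add0r.
Qed.

(* Average v * rho (1 + w^(l-1-i) Z) over 1 + w^i Y against theta0. Translating
   back by (1 + w^(l-1-i) Z)^-1 and summing over Z kills every Y that does not
   commute with X modulo w, hence leaves a nonzero multiple of v; so some
   average is nonzero. *)
Lemma descent_step i (v : 'rV[algC]_d) : (i < l.-1)%N -> v != 0 ->
  (forall T, v *m r (1 + w ^+ l.-1 *: T) = psi (w ^+ l.-1 *: (X * T)) *: v) ->
  (forall Z, strict_upper Z ->
     v *m r (1 + w ^+ i.+1 *: Z) = theta0 (1 + w ^+ i.+1 *: Z) *: v) ->
  exists v' : 'rV[algC]_d, [/\ v' != 0,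
    (0 < i)%N -> forall T, v' *m r (1 + w ^+ l.-1 *: T) = psi (w ^+ l.-1 *: (X * T)) *: v' &
    forall Z, strict_upper Z -> v' *m r (1 + w ^+ i *: Z) = theta0 (1 + w ^+ i *: Z) *: v'].
Proof.
move=> il v0 hK hU; pose c := (l.-1 - i)%N.
have c0 : (0 < c)%N by rewrite subn_gt0.
have ci : (c + i = l.-1)%N by rewrite subnK // ltnW.
have l1 : (0 < l.-1)%N by rewrite -subn1 subn_gt0.
have lS : (l <= (l.-1).+1)%N by rewrite prednK // ltnW.
pose kz Z := 1 + w ^+ c *: Z; pose uy Y := 1 + w ^+ i *: Y.
have lc : (l <= l.-1 + c)%N by rewrite (leq_trans lS) // -addn1 leq_add2l.
have ukz Z : kz Z \is a GRing.unit by apply: unit_1w.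
have ut (T : 'M[R]_n.+1) : 1 + w ^+ l.-1 *: T \is a GRing.unit by apply: unit_1w.
pose W Z := \sum_(Y | strictb Y) (theta0 (uy Y))^-1 *: (v *m r (kz Z) *m r (uy Y)).
have W_U Z Y0 : strict_upper Y0 -> W Z *m r (uy Y0) = theta0 (uy Y0) *: W Z.
  move=> hY0; have uu0 : unipotent (uy Y0) by apply/unipotent_strict/strict_upperZ.
  (* This map is right multiplication by [uy Y0] in the coordinate Y. *)
  have inj : injective (fun Y => Y * uy Y0 + Y0).
    by move=> Y Y' /addIr/(mulIr (unipU i hY0)).
  rewrite mulmx_suml scaler_sumr [RHS](reindex_inj inj) /=.
  apply: eq_big => [Y|Y /strictbP hY].
    apply/strictbP/strictbP=> hY.
      by apply: strict_upper_add => //; apply: strict_upper_mulr => //; apply: unipotent_upper.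
    apply: (strict_upper_cancelr uu0); rewrite -[_ * _](addrK Y0).
    by apply: strict_upper_add => //; apply: strict_upperN.
  have -> : uy (Y * uy Y0 + Y0) = uy Y * uy Y0.
    rewrite /uy [RHS]mulrDl mul1r [Y * _]mulrDr mulr1 -[RHS]addrA !scalerDr.
    by rewrite -!scalerAl mulrDr mulr1 scalerDr -scalerAr addrCA [w ^+ i *: Y0 + _]addrC !addrA.
  have uuY : unipotent (uy Y) by apply/unipotent_strict/strict_upperZ.
  rewrite rM ?unipU // theta0_mul // -scalemxAl scalerA -!mulmxA; congr (_ *: _).
  by rewrite invfM mulrCA mulfV ?mulr1 // theta0_neq0.
(* For i > 0 the level l - 1 subgroup commutes with every [uy Y]; this fails at i = 0, where the
   descent ends anyway. *)
have W_K Z : (0 < i)%N -> forall T,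
    W Z *m r (1 + w ^+ l.-1 *: T) = psi (w ^+ l.-1 *: (X * T)) *: W Z.
  move=> i0 T; rewrite mulmx_suml scaler_sumr; apply: eq_bigr => Y /strictbP hY.
  rewrite -scalemxAl scalerA mulrC -scalerA; congr (_ *: _).
  have uY : uy Y \is a GRing.unit by apply: unipU.
  have c1 : uy Y * (1 + w ^+ l.-1 *: T) = (1 + w ^+ l.-1 *: T) * uy Y.
    by apply: comm_1w; rewrite (leq_trans lS) // -addn1 addnC leq_add2r.
  have c2 : kz Z * (1 + w ^+ l.-1 *: T) = (1 + w ^+ l.-1 *: T) * kz Z.
    by apply: comm_1w; rewrite (leq_trans lS) // -addn1 addnC leq_add2r.
  have r1 : r (uy Y) *m r (1 + w ^+ l.-1 *: T) = r (1 + w ^+ l.-1 *: T) *m r (uy Y).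
    by rewrite -!rM // c1.
  have r2 : r (kz Z) *m r (1 + w ^+ l.-1 *: T) = r (1 + w ^+ l.-1 *: T) *m r (kz Z).
    by rewrite -!rM // c2.
  rewrite -[_ *m r (uy Y) *m _]mulmxA r1 mulmxA -[v *m _ *m r (1 + _)]mulmxA r2.
  by rewrite mulmxA hK -!scalemxAl.
(* The commutator of [kz Z] and [uy Y] has level c + i = l - 1; [A_ Y] is the parameter of its
   character value as a function of Z. *)
pose A_ Y := w ^+ l.-1 *: (Y * (uy Y)^-1 * X - (uy Y)^-1 * X * Y).
have conjE Z Y : strict_upper Y -> v *m r (kz Z) *m r (uy Y) *m r (kz Z)^-1 =
    psi (A_ Y * Z) *: (v *m r (uy Y)).
  move=> hY; have uY := unipU i hY; rewrite -/(uy Y) in uY.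
  have ukV : (kz Z)^-1 \is a GRing.unit by rewrite unitrV.
  pose T := (Z * Y - Y * Z) * (uy Y)^-1.
  rewrite -!mulmxA -!rM ?unitrMl //.
  have -> : kz Z * (uy Y * (kz Z)^-1) = (1 + w ^+ l.-1 *: T) * uy Y.
    apply: (mulIr (ukz Z)); have -> : (1 + w ^+ l.-1 *: T) * uy Y = uy Y + w ^+ l.-1 *: (Z * Y - Y * Z).
      by rewrite [LHS]mulrDl mul1r -scalerAl /T mulrVK.
    have eK (K : 'M[R]_n.+1) : w ^+ l.-1 *: (K * kz Z) = w ^+ l.-1 *: K.
      rewrite /kz mulrDr mulr1 scalerDr -scalerAr scalerA -exprD.
      by rewrite (w_exp0 lc) scale0r addr0.
    rewrite !mulrA mulrVK // [RHS]mulrDl -[in RHS]scalerAl eK.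
    rewrite /kz /uy !mulrDl !mulrDr !mul1r !mulr1 -!scalerAl -!scalerAr !scalerA.
    rewrite -!exprD [(i + c)%N]addnC ci scalerBr -!addrA; congr (_ + _).
    rewrite [RHS]addrCA; congr (_ + _); congr (_ + _).
    by rewrite addrC subrK.
  rewrite rM // mulmxA hK -scalemxAl; congr (_ *: _).
  rewrite /psi -scalerAl !mxtraceZ; congr (phi (_ * _)).
  rewrite /T; move: (uy Y)^-1 => U; rewrite !mulrBl mulrBr !raddfB /=; congr (_ - _).
    have -> : X * (Z * Y * U) = (X * Z) * (Y * U) by rewrite !mulrA.
    by rewrite trace_mulC !mulrA.
  by rewrite mulrA trace_mulC !mulrA.
pose S := \sum_Z W Z *m r (kz Z)^-1.
have SE : S = (\sum_(Y | strictb Y) (A_ Y == 0)%:R * #|{: 'M[R]_n.+1}|%:R) *: v.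
  rewrite /S; under eq_bigr => Z _ do rewrite mulmx_suml.
  rewrite exchange_big /= scaler_suml; apply: eq_bigr => Y /strictbP hY.
  rewrite (eq_bigr (fun Z => psi (A_ Y * Z) *: ((theta0 (uy Y))^-1 *: (v *m r (uy Y))))); last first.
    by move=> Z _; rewrite -scalemxAl conjE // !scalerA mulrC.
  rewrite -scaler_suml; have [A0|A0] := eqVneq (A_ Y) 0; last by rewrite sum_psi // mul0r !scale0r.
  rewrite mul1r (eq_bigr (fun=> 1)) => [|Z _]; last by rewrite A0 mul0r psi0.
  rewrite sumr_const; congr (_ *: _).
  have [|Z hZ eZ] := descent_centralizer hY.
    have uY : uy Y \is a GRing.unit by apply: unipU.
    have cY : uy Y * Y = Y * uy Y by rewrite /uy mulrDl mulrDr mul1r mulr1 -scalerAl -scalerAr.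
    have := congr1 ( *%R (uy Y)) A0; rewrite /A_ mulr0 -scalerAr mulrBr !mulrA cY.
    by rewrite mulrK // mulrV // mul1r.
  have -> : uy Y = 1 + w ^+ i.+1 *: Z by rewrite /uy eZ scalerA -exprSr.
  by rewrite hU // scalerA mulVf ?scale1r // theta0_neq0.
(* The coefficient of v in S is a sum of nonnegative terms, positive at Y = 0, so S is nonzero. *)
have /existsP[Z WZ] : [exists Z, W Z != 0].
  apply: contraT => /existsPn H; have : S = 0.
    by rewrite /S big1 // => Z _; have /negPn/eqP -> := H Z; rewrite mul0mx.
  rewrite SE => /eqP; rewrite scaler_eq0 (negbTE v0) orbF.
  have s0 : strictb 0 by apply/strictbP=> a b _; rewrite mxE.
  rewrite (bigD1 0) //= {1}/A_ mulr0 mul0r mul0r subr0 scaler0 eqxx mul1r.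
  rewrite paddr_eq0 ?ler0n //; last first.
    by apply: sumr_ge0 => Y _; rewrite mulr_ge0 ?ler0n.
  by rewrite pnatr_eq0 (cardD1 0) inE.
by exists (W Z); split=> // [i0 T|Y hY]; [exact: W_K | exact: W_U].
Qed.

(** As X is Hessenberg, its character agrees with [theta0] on the unipotent elements of level l - 1;
    l - 1 descent steps then reach level 0, which is U. *)
Lemma whittaker_vector (v0 : 'rV[algC]_d) : v0 != 0 ->
  (forall T, v0 *m r (1 + w ^+ l.-1 *: T) = psi (w ^+ l.-1 *: (X * T)) *: v0) ->
  exists2 v : 'rV[algC]_d, v != 0 & forall u, unipotent u -> v *m r u = theta0 u *: v.
Proof.
move=> v00 hK0.
have H j : (j <= l.-1)%N -> exists v : 'rV[algC]_d, [/\ v != 0,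
    (0 < l.-1 - j)%N -> forall T,
      v *m r (1 + w ^+ l.-1 *: T) = psi (w ^+ l.-1 *: (X * T)) *: v &
    forall Z, strict_upper Z ->
      v *m r (1 + w ^+ (l.-1 - j) *: Z) = theta0 (1 + w ^+ (l.-1 - j) *: Z) *: v].
  elim: j => [|j IH] jl.
    exists v0; split=> // Z hZ; rewrite subn0 hK0 (theta0_strict hX).
      by rewrite -scalerAr.
    exact: strict_upperZ.
  have [v [vn hK hU]] := IH (ltnW jl); apply: (descent_step _ vn).
  - by rewrite ltn_subrL /= -subn1 subn_gt0.
  - by apply: hK; rewrite subn_gt0.
  by move=> Z hZ; rewrite -subSn // subSS hU.
have [v [vn _ hU]] := H _ (leqnn _); exists v => // u hu.
have := hU _ hu; rewrite subnn scale1r.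
by rewrite addrC subrK.
Qed.
End Descent.

(** * Whittaker models of regular representations of GL *)

Local Notation U := (@U_group R n.+1).
Local Notation K := (@K_group R n.+1 w l).

Lemma U_P (g : gT) : reflect (unipotent (GLval g)) (g \in U).
Proof.
rewrite inE; apply: (iffP idP) => [/forallP H|/unipotentP[hu hd]].
  apply/unipotentP; split=> [i j ji|i].
    by have /forallP/(_ j)/andP[/implyP/(_ ji)/eqP] := H i.
  by have /forallP/(_ i)/andP[_ /implyP/(_ (eqxx i))/eqP] := H i.
apply/forallP=> i; apply/forallP=> j; apply/andP; split; apply/implyP.
  by move=> ji; rewrite hu.
by move=> /eqP <-; rewrite hd.
Qed.

Lemma K_P (g : gT) : reflect (exists T, GLval g = 1 + w ^+ l.-1 *: T) (g \in K).
Proof.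
rewrite inE; apply: (iffP idP) => [/forallP H|[T eT]]; last first.
  apply/forallP=> i; apply/forallP=> j; apply/existsP; exists (T i j).
  have := congr1 (fun M : 'M[R]_n.+1 => (M - 1) i j) eT.
  by rewrite /= [1 + _]addrC addrK [in RHS]mxE => <-; rewrite !mxE.
have c i j : {b : R | GLval g i j - (1%:M : 'M[R]_n.+1) i j = w ^+ l.-1 * b}.
  have /forallP/(_ j)/existsP := H i.
  by case/sigW=> b /eqP e; exists b.
exists (\matrix_(i, j) sval (c i j)); apply/matrixP=> i j.
by rewrite !mxE -(svalP (c i j)) !mxE addrC subrK.
Qed.

Lemma cf_of_linear (G : {group gT}) (f : gT -> algC) :
  f 1%g = 1 -> {in G &, {morph f : x y / (x * y)%g >-> x * y}} ->
  {in G, cf_of G f =1 f} /\ cf_of G f \is a linear_char.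
Proof.
move=> f1 fM.
have fV x : x \in G -> f x^-1%g * f x = 1.
  by move=> Gx; rewrite -fM ?groupV // mulVg.
have fJ : is_class_fun <<G>>%g [ffun x => if x \in G then f x else 0].
  rewrite genGid; apply: intro_class_fun => [x y Gx Gy|x /negbTE->] //.
  rewrite groupJ // Gx conjgE !fM ?groupM ?groupV //.
  by rewrite mulrCA fV // mulr1.
have e : {in G, cf_of G f =1 f}.
  move=> x Gx; rewrite -[LHS]/(val (cf_of G f) x) /cf_of.
  by rewrite (insubdK (0 : 'CF(G)) fJ) ffunE Gx.
by split=> //; apply: (hom_linear_char (f := f)).
Qed.

Definition theta_std : 'CF(U) := cf_of U (fun g : gT => theta0 (GLval g)).

Lemma theta0_1 : theta0 1 = 1.
Proof. by rewrite /theta0 subrr mulr0 psi0. Qed.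

Lemma theta_std_spec :
  {in U, forall g : gT, theta_std g = theta0 (GLval g)} /\ theta_std \is a linear_char.
Proof.
apply: cf_of_linear; first exact: theta0_1.
by move=> x y /U_P hx /U_P hy; apply: theta0_mul.
Qed.

Lemma phiX_spec (K' : {group gT}) X : (2 <= l)%N -> K' \subset K ->
  {in K', forall g : gT, phiX K' phi X g = psi (X * (GLval g - 1))} /\
  phiX K' phi X \is a linear_char.
Proof.
move=> l2 /subsetP sK; apply: cf_of_linear; first by rewrite subrr mulmx0 mxtrace0 addchar_0.
move=> x y /sK/K_P[S eS] /sK/K_P[T eT].
rewrite -[LHS]/(psi (X * (GLval (x * y) - 1))) -[RHS]/(psi (X * (GLval x - 1)) * psi (X * (GLval y - 1))).
rewrite GL_ME eS eT -psiD -mulrDr; congr psi; congr (_ * _).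
have e : w ^+ (l.-1 + l.-1) = 0 by apply: w_exp0; have := l2; clear; lia.
have addK1 (A : 'M[R]_n.+1) : 1 + A - 1 = A by rewrite addrC addKr.
rewrite mulrDl mul1r mulrDr mulr1 -scalerAl -scalerAr scalerA -exprD e.
by rewrite scale0r addr0 -[1 + _ + _]addrA !addK1 addrC.
Qed.

Section Whittaker.
Hypothesis l_ge2 : (2 <= l)%N.
Hypothesis two_k : (2%:R : k) != 0.

Definition anti (g : gT) : gT := toGL (star (GLval g)).

Lemma antiE (g : gT) : GLval (anti g) = star (GLval g).
Proof. by rewrite toGLK // star_unit; apply: (valP g). Qed.

Lemma whittaker_mult_one d (rho : mx_representation algC [set: gT] d) :
  mx_irreducible rho -> lin_proj rho theta_std != 0 ->
  '['Res[U] (cfRepr rho), theta_std] = 1.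
Proof.
move=> irr_rho; have [thE th_lin] := theta_std_spec.
apply: (@gelfand_dot _ _ _ _ _ th_lin irr_rho anti).
- by move=> x y; apply: val_inj; rewrite [LHS]antiE [RHS]GL_ME !antiE GL_ME starM.
- by move=> x; apply: val_inj; rewrite [LHS]antiE antiE starK.
- move=> x; apply/U_P/U_P; rewrite antiE => h; last exact: star_unipotent.
  by rewrite -[GLval x]starK; apply: star_unipotent.
- move=> x; have [Ux|nUx] := boolP (x \in U).
    rewrite !thE ?antiE ?theta0_star //.
    by apply/U_P; rewrite antiE; apply/star_unipotent/U_P.
  rewrite !cfun0 //; apply: contra nUx => /U_P; rewrite antiE => h.
  by apply/U_P; rewrite -[GLval x]starK; apply: star_unipotent.
move=> f fl fr fs g.
(* Extension by 0 to the singular matrices gives a function on all of M_n, as [gelfand_vanish]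
   expects. *)
pose h A := if A \is a GRing.unit then f (toGL A) else 0.
have toU u : unipotent u -> toGL u \in U.
  by move=> hu; apply/U_P; rewrite toGLK ?unipotent_unit.
have thU u : unipotent u -> theta_std (toGL u) = theta0 u.
  by move=> hu; rewrite thE ?toU // toGLK // unipotent_unit.
have := @gelfand_vanish l_ge2 two_k h _ _ _ (GLval g) (valP g).
rewrite /h (valP g) GLvalK; apply.
- move=> u A hu; have uu := unipotent_unit hu; rewrite unitrMr //.
  by case: ifP => uA; rewrite ?mulr0 // toGLM // fl ?toU // thU.
- move=> u A hu; have uu := unipotent_unit hu; rewrite unitrMl //.
  by case: ifP => uA; rewrite ?mulr0 // toGLM // fr ?toU // thU.
move=> A; rewrite star_unit; case: ifP => uA; last by rewrite oppr0.
by rewrite -fs; congr f; apply: val_inj; rewrite [LHS]toGLK ?star_unit // [RHS]antiE toGLK.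
Qed.

(** A nonzero row of the projector of phi_X is the starting vector of the descent; its outcome makes
    the projector of theta nonzero, and multiplicity one concludes. *)
Lemma hess_whittaker (chi : 'CF([set: gT])) X : chi \in irr [set: gT] -> hess X ->
  '['Res[K] chi, phiX K phi X] != 0 -> '['Res[U] chi, theta_std] = 1.
Proof.
case/irrP=> i -> hX; rewrite -irrRepr => h.
have [phE ph_lin] := phiX_spec X l_ge2 (subxx K).
have [thE th_lin] := theta_std_spec.
apply: whittaker_mult_one; first exact: socle_irr.
have P0 : lin_proj 'Chi_i (phiX K phi X) != 0.
  by apply: contraNneq h => P0; rewrite -lin_proj_trace ?P0 ?mxtrace0.
have [s Ps] : exists s, row s (lin_proj 'Chi_i (phiX K phi X)) != 0.
  apply/existsP; apply: contraNT P0 => /existsPn H; apply/eqP/row_matrixP=> s.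
  by have /negPn/eqP -> := H s; rewrite row0.
have l10 : (0 < l.-1)%N by rewrite -subn1 subn_gt0.
have [|v v0 hv] := whittaker_vector (rho := 'Chi_i) hX l_ge2 Ps.
  move=> T; have ut := unit_1w T l10.
  have Kt : toGL (1 + w ^+ l.-1 *: T) \in K by apply/K_P; exists T; rewrite toGLK.
  rewrite -row_mul lin_projr // linearZ /= phE // toGLK //.
  by rewrite [1 + _]addrC addrK -scalerAr.
apply: (lin_proj_neq0 th_lin v0) => x Ux.
by rewrite thE // -hv; [rewrite GLvalK | apply/U_P].
Qed.

(** * From SL to GL *)

Local Notation SL := (@SL_group R n.+1).
Local Notation KSL := (K :&: SL)%G.

Lemma SL_P (g : gT) : (g \in SL) = (\det (GLval g) == 1).
Proof. by rewrite inE. Qed.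

Lemma normal_SL (t : gT) : t \in 'N(SL)%g.
Proof.
rewrite inE; apply/subsetP=> _ /imsetP[x SLx ->]; rewrite SL_P.
move: SLx; rewrite SL_P => /eqP dx.
rewrite conjgE !GL_MxE GL_VxE !det_mulmx dx mul1r -det_mulmx mulVmx ?det1 //.
exact: (valP t).
Qed.

Lemma normal_K (t : gT) : t \in 'N(K)%g.
Proof.
rewrite inE; apply/subsetP=> _ /imsetP[x /K_P[T eT] ->]; apply/K_P.
exists ((GLval t)^-1 * T * GLval t).
rewrite conjgE !GL_ME GL_VE eT mulrDl mul1r mulrDr -scalerAl -scalerAr mulrA.
by rewrite mulVr // (valP t).
Qed.

Lemma U_sub_SL : U \subset SL.
Proof.
apply/subsetP=> x /U_P/unipotentP[hu hd]; rewrite SL_P -det_tr det_trig.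
  by rewrite big1 // => i _; rewrite mxE hd.
by apply/is_trig_mxP=> i j ij; rewrite mxE hu.
Qed.

Lemma cfRes_conjg (G H : {group gT}) (f : 'CF(G)) (t : gT) : H \subset G ->
  t \in 'N(G)%g -> t \in 'N(H)%g -> 'Res[H] (f ^ t)%CF = ('Res[H] f ^ t)%CF.
Proof.
move=> sHG nG nH; apply/cfun_inP=> x Hx.
rewrite cfResE // !cfConjgE // cfResE // -[x]invgK.
by rewrite -mem_conjg (normP nH) invgK.
Qed.

Lemma cfRes_conjg_full (H : {group gT}) (f : 'CF([set: gT])) (t : gT) :
  t \in 'N(H)%g -> ('Res[H] f ^ t)%CF = 'Res[H] f.
Proof.
move=> nH; rewrite -cfRes_conjg ?subsetT //; last by rewrite (subsetP (normG _)) ?inE.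
by rewrite cfConjg_id ?inE.
Qed.

Lemma phiX_conj (chi : 'CF([set: gT])) X (t : gT) :
  '['Res[K] chi, phiX K phi X] =
  '['Res[K] chi, phiX K phi ((GLval t)^-1 * X * GLval t)].
Proof.
rewrite -(cfConjg_iso t) cfRes_conjg_full ?normal_K //; congr '[_, _].
have [phE _] := phiX_spec X l_ge2 (subxx K).
have [phE' _] := phiX_spec ((GLval t)^-1 * X * GLval t) l_ge2 (subxx K).
apply/cfun_inP=> x Kx; rewrite cfConjgE ?normal_K // phE' // phE; last first.
  by rewrite -mem_conjg (normP (normal_K t)).
have ut : GLval t \is a GRing.unit by apply: (valP t).
rewrite conjgE invgK !GL_ME GL_VE -!mulrA [in RHS]psiC -!mulrA.
by rewrite [(_ - 1) * _]mulrBl [in RHS]mulrBr mul1r mulrV.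
Qed.

Lemma phiX_cong X Z : phiX K phi (X + w *: Z) = phiX K phi X.
Proof.
have [phE _] := phiX_spec X l_ge2 (subxx K).
have [phE' _] := phiX_spec (X + w *: Z) l_ge2 (subxx K).
apply/cfun_inP=> x Kx; rewrite phE // phE' //; have [T ->] := K_P _ Kx.
rewrite [1 + _]addrC addrK mulrDl.
have -> : (w *: Z) * (w ^+ l.-1 *: T) = 0.
  by rewrite -scalerAl -scalerAr scalerA -exprS prednK ?wl0 ?scale0r // ltnW.
by rewrite addr0.
Qed.

(** Over the residue field X is conjugate to a Hessenberg matrix. After lifting the conjugator,
    overwriting the entries below the diagonal by exact 0 and 1 changes X only modulo w, hence
    leaves phi_X alone. *)
Lemma regular_GL_whittaker (chi : 'CF([set: gT])) : chi \in irr [set: gT] ->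
  regular_GL w l red phi chi -> '['Res[U] chi, theta_std] = 1.
Proof.
move=> irr_chi [X [/eqP reg hX]].
have [g0 ug0 hg0] := @regular_hess k n (map_mx red X) reg.
have [g eg _] := lift_mx g0.
have ug : g \is a GRing.unit.
  rewrite -[_ \is a _]/(g \in unitmx) unitmxE; apply: red_unit.
  by rewrite -det_map_mx eg -unitfE -unitmxE.
have rX : map_mx red (g^-1 * X * g) = g0^-1 * map_mx red X * g0.
  by rewrite !rmorphM /= rmorphV //= eg.
pose X' : 'M[R]_n.+1 := \matrix_(i, j)
  if (j < i)%N then (i == j.+1 :> nat)%:R else (g^-1 * X * g) i j.
have hX' : hess X' by move=> i j ji; rewrite mxE ji.
have [|Z eZ] := @red_mx_cong (g^-1 * X * g) X'.
  apply/matrixP=> i j; rewrite [RHS]mxE [X' i j]mxE; case: ifP => ji; last by rewrite mxE.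
  by rewrite rmorph_nat rX hg0.
apply: (hess_whittaker irr_chi hX').
rewrite -(phiX_cong X' Z) -eZ.
by have := phiX_conj chi X (toGL g); rewrite toGLK // => <-.
Qed.

Lemma sum_addchar_scale s : \sum_(a : R) phi (a * s) = (s == 0)%:R * #|R|%:R.
Proof.
have [->|s0] := eqVneq s 0.
  rewrite (eq_bigr (fun=> 1)) ?sumr_const ?mul1r // => a _.
  by rewrite mulr0 addchar_0.
rewrite mul0r; apply: (@sum_addchar R (fun a => phi (a * s))) => [a b|].
  by rewrite mulrDl addchar_add.
have /existsP[a ha] : [exists a, phi (a * s) != 1]; last by exists a.
apply: contraNT s0 => /existsPn H; apply/eqP/addchar_nondegenerate => b.
by rewrite mulrC; have /negPn/eqP := H b.
Qed.

Lemma K_SL_trace (g : gT) : g \in K -> (g \in SL) = (\tr (GLval g - 1) == 0).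
Proof.
case/K_P=> T eT; rewrite SL_P eT det_1_nilpotent; last first.
  by rewrite -exprD; apply: w_exp0; have := l_ge2; clear; lia.
rewrite [1 + _]addrC -subr_eq0 addrK [1 + _]addrC addrK.
by rewrite mxtraceZ.
Qed.

Lemma cfdot_lin_ge0 (H : {group gT}) (f lam : 'CF(H)) :
  f \is a character -> lam \is a linear_char -> 0 <= '[f, lam].
Proof. by move=> cf cl; rewrite natr_ge0 // Cnat_cfdot_char // lin_charW. Qed.

(* The sum over a of phi_(X + a) is |R| phi_X on K :&: SL and 0 elsewhere on K;
   so chi contains some phi_(X + a). *)
Lemma regular_SL_GL (chi : 'CF([set: gT])) (eta : 'CF(SL)) :
  chi \in irr [set: gT] -> eta \in irr SL -> '['Res[SL] chi, eta] != 0 ->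
  regular_SL w l red phi eta -> regular_GL w l red phi chi.
Proof.
move=> irr_chi /irrP[j ->] hj [X [_ reg hX]].
have cchi : chi \is a character by apply: irrWchar.
have sKSL : KSL \subset K by apply: subsetIl.
have [phE ph_lin] := phiX_spec X l_ge2 sKSL.
have h1 : '['Res[KSL] chi, phiX KSL phi X] != 0.
  have : j \in irr_constt ('Res[SL] chi) by rewrite irr_consttE.
  case/constt_charP=> [|eta' ceta' e]; first by rewrite cfRes_char.
  have -> : 'Res[KSL] chi = 'Res[KSL] 'chi_j + 'Res[KSL] eta'.
    by rewrite -linearD /= -e cfResRes ?subsetIr ?subsetT.
  rewrite cfdotDl paddr_eq0 ?(negbTE hX) //; apply: cfdot_lin_ge0 => //;
    by rewrite cfRes_char // irr_char.
pose f a := phiX K phi (X + a%:M).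
have /existsP[a ha] : [exists a : R, '['Res[K] chi, f a] != 0].
  apply: contraNT h1 => /existsPn H.
  have S0 : \sum_a '['Res[K] chi, f a] = 0.
    by rewrite big1 // => a _; have /negPn/eqP := H a.
  have : \sum_a '['Res[K] chi, f a] =
      #|K|%:R^-1 * (#|R|%:R * \sum_(x in KSL) chi x * (phiX KSL phi X x)^*).
    rewrite (eq_bigr (fun a => #|K|%:R^-1 * \sum_(x in K) chi x * (f a x)^*)); last first.
      by move=> a _; rewrite cfdotE; congr (_ * _); apply: eq_bigr => x Kx; rewrite cfResE ?subsetT.
    transitivity (#|K|%:R^-1 * \sum_a \sum_(x in K) chi x * (f a x)^*).
      by rewrite mulr_sumr.
    congr (_ * _); rewrite exchange_big /= mulr_sumr.
    rewrite [RHS](eq_bigl (fun x => (x \in K) && (x \in SL))); last by move=> x; rewrite inE.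
    rewrite [RHS]big_mkcondr /=; apply: eq_bigr => x Kx.
    rewrite -mulr_sumr -rmorph_sum /=.
    have -> : \sum_a f a x = psi (X * (GLval x - 1)) * ((x \in SL)%:R * #|R|%:R).
      rewrite K_SL_trace // -sum_addchar_scale mulr_sumr; apply: eq_bigr => a _.
      have [fE _] := phiX_spec (X + a%:M) l_ge2 (subxx K).
      rewrite fE // mulrDl psiD; congr (_ * _).
      by rewrite /psi -[a%:M * _]/(a%:M *m _) mul_scalar_mx mxtraceZ.
    case: ifP => SLx; last by rewrite mul0r mulr0 conjC0 mulr0.
    have cM (c d : algC) : (c * d)^* = c^* * d^* by apply: rmorphM.
    have KSLx : x \in KSL by rewrite inE Kx.
    by rewrite (phE _ KSLx) mul1r cM conjC_nat; ring.
  rewrite S0 => /esym/eqP; rewrite !mulf_eq0 invr_eq0 (negbTE (card_H_neq0 _)) /=.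
  rewrite pnatr_eq0 (cardD1 0) inE /= => /eqP e0.
  apply/orP; right; apply/eqP; rewrite -[RHS]e0.
  by apply: eq_bigr => x Hx; rewrite cfResE ?subsetT.
exists (X + a%:M); split; last exact: ha.
by rewrite map_mxD map_scalar_mx; apply: regular_mx_shift.
Qed.

Lemma trace_shift (M : 'M[R]_n.+1) :
  \tr (shift * M) = \sum_(i < n) M (inord i) (inord i.+1).
Proof.
rewrite /mxtrace big_ord_recl -mulmxE mxE big1 => [|j _]; last by rewrite mxE mul0r.
rewrite add0r; apply: eq_bigr => i _; rewrite mxE (bigD1 (inord i)) //= mxE.
have ei : (inord i : 'I_n.+1) = i :> nat by rewrite inordK // ltnW // ltnS.
have el : lift ord0 i = inord i.+1 by apply: val_inj; rewrite /= inordK // ltnS.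
rewrite el ei inordK ?ltnS // eqxx mul1r big1 ?addr0 // => j ji.
rewrite mxE inordK ?ltnS // eqSS (_ : _ == _ = false) ?mul0r //.
by apply: contraNF ji => /eqP e; apply/eqP/val_inj; rewrite /= ei.
Qed.

Lemma cf_of_ext (G : {group gT}) (f f' : gT -> algC) :
  {in G, f =1 f'} -> cf_of G f = cf_of G f'.
Proof.
move=> e; congr insubd; apply/ffunP=> x; rewrite !ffunE.
by case: ifP => // /e.
Qed.

(** * Diagonal conjugation of the non-degenerate characters *)

Section Diagonal.
Variable d : 'I_n.+1 -> R.
Hypothesis d_unit : forall i, d i \is a GRing.unit.

Definition diag_elt : gT := toGL (diag_mx (\row_i d i)).

Lemma diag_eltE : GLval diag_elt = diag_mx (\row_i d i) /\
  (GLval diag_elt)^-1 = diag_mx (\row_i (d i)^-1).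
Proof.
have m1 : diag_mx (\row_i d i) * diag_mx (\row_i (d i)^-1) = 1 :> 'M[R]_n.+1.
  rewrite -mulmxE mulmx_diag; apply/matrixP=> i j; rewrite !mxE.
  by case: eqP => [->|_]; rewrite ?mulr0n // mulrV.
have uD : diag_mx (\row_i d i) \is a @GRing.unit 'M[R]_n.+1.
  by case: (mulmx1_unit m1).
have eD : GLval diag_elt = diag_mx (\row_i d i) by rewrite toGLK.
by split=> //; rewrite eD; apply: (mulrI uD); rewrite m1 mulrV.
Qed.

Lemma diag_conjE (x : gT) i j :
  GLval (x ^ diag_elt)%g i j = (d i)^-1 * GLval x i j * d j.
Proof.
have [eD eV] := diag_eltE.
rewrite conjgE !GL_ME GL_VE eV eD -!mulmxE mulmxA mul_mx_diag mul_diag_mx.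
by rewrite !mxE.
Qed.

Lemma diag_normal : diag_elt \in 'N(U)%g.
Proof.
rewrite inE; apply/subsetP=> _ /imsetP[x /U_P/unipotentP[hu hd] ->].
apply/U_P/unipotentP; split=> [i j ji|i]; rewrite diag_conjE.
  by rewrite hu // mulr0 mul0r.
by rewrite hd mulr1 mulVr.
Qed.

Lemma theta_diag (phis : 'I_n -> R -> algC) :
  (forall (i : 'I_n) a, phis i a = phi ((d (inord i))^-1 * d (inord i.+1) * a)) ->
  @theta R n.+1 phis = (theta_std ^ diag_elt^-1)%CF.
Proof.
move=> hphi; have [thE th_lin] := theta_std_spec.
have nD := diag_normal.
have UJ x : x \in U -> (x ^ diag_elt)%g \in U by move=> Ux; rewrite memJ_norm.
have [||e _] := @cf_of_linear U (fun x : gT => theta0 (GLval (x ^ diag_elt)%g)).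
- by rewrite conj1g theta0_1.
- move=> x y Ux Uy; rewrite -theta0_mul; [|by apply/U_P/UJ..].
  by rewrite conjMg.
have -> : @theta R n.+1 phis = cf_of U (fun x : gT => theta0 (GLval (x ^ diag_elt)%g)).
  apply: cf_of_ext => x Ux; rewrite /theta0 /psi trace_shift.
  rewrite (big_morph phi (addchar_add) addchar_0); apply: eq_bigr => i _.
  have sub1 (M : 'M[R]_n.+1) a b : (M - 1) a b = M a b - (a == b)%:R.
    by rewrite !mxE.
  rewrite hphi sub1 diag_conjE.
  have ne : (inord i == inord i.+1 :> 'I_n.+1) = false.
    by rewrite -val_eqE /= !inordK ?ltnS //; [rewrite ltn_eqF | rewrite ltnW ?ltnS].
  by rewrite ne subr0 mulrAC.
apply/cfun_inP=> x Ux; rewrite e // cfConjgE ?groupV // invgK thE //.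
exact: UJ.
Qed.
End Diagonal.

(** By Fourier inversion phi' correlates with some a -> phi (c a), and then equals it. A non-unit c
    would make phi' trivial on w^(l-1) R. *)
Lemma primitive_dual (phi' : R -> algC) : primitive_char w l phi' ->
  exists2 c, c \is a GRing.unit & forall a, phi' a = phi (c * a).
Proof.
move=> [[p0 pD] [b hb]].
have /existsP[c hc] : [exists c : R, \sum_a phi' a * phi (- (c * a)) != 0].
  apply: contraT => /existsPn H.
  have : \sum_c \sum_a phi' a * phi (- (c * a)) = 0.
    by apply: big1 => c _; have /negPn/eqP := H c.
  rewrite exchange_big /= (bigD1 0) //= [X in _ + X]big1 => [|a a0]; last first.
    rewrite -mulr_sumr (eq_bigr (fun c => phi (c * - a))) => [|c _]; last by rewrite mulrN.
    by rewrite sum_addchar_scale oppr_eq0 (negbTE a0) mul0r mulr0.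
  rewrite -mulr_sumr p0 mul1r addr0 (eq_bigr (fun=> 1)) => [|c _].
    rewrite sumr_const => /eqP; rewrite -[#|_|%:R]/(#|R|%:R) pnatr_eq0.
    by rewrite (cardD1 0).
  by rewrite mulr0 oppr0 addchar_0.
have e a : phi' a * phi (- (c * a)) = 1.
  apply/eqP; apply: contraNT hc => ha; apply/eqP.
  apply: (@sum_addchar R (fun a => phi' a * phi (- (c * a)))); last by exists a.
  by move=> x y; rewrite pD mulrDr opprD addchar_add mulrACA.
have e' a : phi' a = phi (c * a).
  have := e a; rewrite addchar_opp => h; apply: (mulIf (invr_neq0 (addchar_neq0 (c * a)))).
  by rewrite h divff // addchar_neq0.
exists c => //; apply: red_unit; apply: contraNneq hb => /red_ker[z ez].
rewrite e' ez; have -> : w * z * (w ^+ l.-1 * b) = w * w ^+ l.-1 * (z * b) by ring.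
by rewrite -exprS prednK ?wl0 ?mul0r ?addchar_0 // ltnW.
Qed.

Lemma has_whittakerE (eta : 'CF(SL)) th :
  has_whittaker eta th = ('['Res[U] eta, th] != 0).
Proof. by rewrite /has_whittaker -cfdot_Res_l. Qed.

Lemma special_whittaker (eta : 'CF(SL)) (phis : 'I_n -> R -> algC) :
  special_regular w l red phi eta -> (forall i, primitive_char w l (phis i)) ->
  has_whittaker eta (@theta R n.+1 phis).
Proof.
move=> [psi' irr_psi [reg <-]] prim; rewrite has_whittakerE.
have /fin_all_exists2[c uc hc] i := primitive_dual (prim i).
(* Partial products, so that the ratio of consecutive diagonal entries is the prescribed c_i. *)
pose d (j : 'I_n.+1) := \prod_(i < n | (i < j)%N) c i.
have ud j : d j \is a GRing.unit.
  by apply: (big_ind (fun x => x \is a GRing.unit)) => // [|x y ux uy];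
    rewrite ?unitr1 // unitrM ux.
have dS (i : 'I_n) : (d (inord i))^-1 * d (inord i.+1) = c i.
  have ei : (inord i : 'I_n.+1) = i :> nat by rewrite inordK // ltnW // ltnS.
  have ed : d (inord i) = \prod_(j < n | (j < i)%N) c j by rewrite /d ei.
  have edS : d (inord i.+1) = c i * \prod_(j < n | (j < i)%N) c j.
    rewrite /d inordK ?ltnS // (bigD1 i) //=; congr (_ * _).
    by apply: eq_bigl => s; rewrite ltnS ltn_neqAle andbC.
  by rewrite edS -ed mulrCA mulVr ?mulr1.
rewrite cfResRes ?U_sub_SL ?subsetT //.
rewrite (theta_diag ud) => [|i a]; last by rewrite dS hc.
have nD : (diag_elt d)^-1%g \in 'N(U)%g by rewrite groupV; apply: diag_normal.
rewrite -(cfRes_conjg_full psi' nD) cfConjg_iso.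
by rewrite regular_GL_whittaker // oner_eq0.
Qed.

Lemma primitive_scale c : c \is a GRing.unit -> primitive_char w l (fun a => phi (c * a)).
Proof.
move=> uc; split.
  by split=> [|a b]; rewrite ?mulr0 ?addchar_0 // mulrDr addchar_add.
case: phi_prim => _ [b hb]; exists (c^-1 * b).
by rewrite mulrCA mulVKr.
Qed.

(** Modulo SL, which acts trivially on eta, y is a diagonal matrix D of the same determinant;
    conjugation by D trades [theta_std] for another non-degenerate character. *)
Lemma conj_whittaker (eta : 'CF(SL)) (y : gT) :
  (forall phis : 'I_n -> R -> algC, (forall i, primitive_char w l (phis i)) ->
     has_whittaker eta (@theta R n.+1 phis)) ->
  '['Res[U] (eta ^ y)%CF, theta_std] != 0.
Proof.
move=> H; pose d (i : 'I_n.+1) := if i == ord0 then \det (GLval y) else 1.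
have ud i : d i \is a GRing.unit.
  rewrite /d; case: ifP => _; last exact: unitr1.
  by rewrite -unitmxE; apply: (valP y).
pose D := diag_elt d; have [eD _] := diag_eltE ud.
have dD : \det (GLval D) = \det (GLval y).
  rewrite eD det_diag (bigD1 ord0) //= mxE /d eqxx big1 ?mulr1 // => i i0.
  by rewrite mxE (negbTE i0).
have nD : D \in 'N(U)%g by apply: diag_normal.
have -> : (eta ^ y)%CF = (eta ^ D)%CF.
  have SLs : (y * D^-1)%g \in SL.
    rewrite SL_P GL_MxE det_mulmx GL_VxE det_inv dD mulrV //.
    by rewrite -unitmxE; apply: (valP y).
  have := cfConjgMnorm eta (normal_SL (y * D^-1)%g) (normal_SL D).
  by rewrite mulgKV (cfConjg_id _ SLs).
rewrite cfRes_conjg ?U_sub_SL ?normal_SL //.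
rewrite -[theta_std](cfConjgKV D) cfConjg_iso.
have := H (fun i a => phi ((d (inord i))^-1 * d (inord i.+1) * a)).
rewrite has_whittakerE (theta_diag ud) //; apply=> i.
by apply: primitive_scale; rewrite unitrM unitrV !ud.
Qed.

Lemma whittaker_special (eta : 'CF(SL)) : eta \in irr SL ->
  regular_SL w l red phi eta ->
  (forall phis : 'I_n -> R -> algC, (forall i, primitive_char w l (phis i)) ->
     has_whittaker eta (@theta R n.+1 phis)) ->
  special_regular w l red phi eta.
Proof.
move=> irr_eta; have [j ej] := irrP irr_eta => reg H.
have [i] := constt_cfInd_irr j (subsetT SL); rewrite constt_Ind_Res => ij.
have nSL : (SL <| [set: gT])%g by rewrite /normal subsetT; apply/subsetP=> t _; apply: normal_SL.
have regi : regular_GL w l red phi 'chi_i.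
  by apply: regular_SL_GL irr_eta _ reg; rewrite ?mem_irr // ej -irr_consttE.
exists 'chi_i; first exact: mem_irr.
split=> //; have := Clifford_Res_sum_cfclass nSL ij.
have := regular_GL_whittaker (mem_irr i) regi.
rewrite -(cfResRes _ U_sub_SL) ?subsetT // => whit eRes.
move: whit; rewrite eRes linearZ linear_sum /= cfdotZl cfdot_suml.
have [thE th_lin] := theta_std_spec.
have nat1 (x : algC) : x \in Num.nat -> x != 0 -> 1 <= x.
  by move=> /natrP[m ->]; rewrite pnatr_eq0 ler1n lt0n.
(* Multiplicity one for ['chi_i] reads 1 = e S, with S the sum of the multiplicities of theta over
   the conjugates of eta. Each of these is at least 1, as is e, so e = 1 and there is one
   conjugate. *)
set e := '[_, _]; have e1 : 1 <= e.
  by apply: nat1; rewrite ?Cnat_cfdot_char_irr ?cfRes_char ?irr_char // -irr_consttE.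
set cls := cfclass _ _.
have a1 c : c \in cls -> 1 <= '['Res[U] c, theta_std].
  move=> /cfclassP[y _ ->]; apply: nat1; last by rewrite -ej conj_whittaker.
  apply: Cnat_cfdot_char; last exact: lin_charW.
  by rewrite cfRes_char // cfConjg_char // irr_char.
have jcls : 'chi_j \in cls by apply/cfclassP; exists 1%g; rewrite ?inE // cfConjgJ1.
have : (size cls)%:R <= \sum_(c <- cls) '['Res[U] c, theta_std].
  rewrite -sum1_size natr_sum big_seq [X in _ <= X]big_seq.
  by apply: ler_sum => c /a1.
set S := \sum_(c <- _) _ => sS eS.
have s1 : (0 < size cls)%N by case: (cls) jcls.
have S1 : 1 <= S by apply: le_trans sS; rewrite ler1n.
have ee : e = 1.
  apply/le_anti; rewrite e1 andbT -eS -[X in X <= _]mulr1.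
  by rewrite ler_wpM2l // (le_trans _ e1) // ler01.
have : (size cls <= 1)%N by rewrite -(ler_nat algC) (le_trans sS) // -eS ee mul1r.
rewrite ee scale1r; case: (cls) jcls => [|c [|c' s]] //.
by rewrite inE => /eqP <- _; rewrite big_seq1 ej.
Qed.
End Whittaker.
End AddChar.
End LocalRing.

Theorem theorem6p6
  (p : nat) (R : finComUnitRingType) (k : finFieldType)
  (red : {rmorphism R -> k}) (w : R) (l n : nat)
  (phi0 : R -> algC) (chi : 'CF(@SL_group R n)) :
  prime p -> odd p -> p \in [pchar k] -> ~~ (p %| n)%N -> (2 <= l)%N ->
  (* R = o_l : a finite local ring with maximal ideal w R, w^l = 0 <> w^(l-1),
     and residue field k = F_q via the reduction map red *)
  w ^+ l = 0 -> w ^+ l.-1 != 0 ->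
  (forall a : k, exists b : R, red b = a) ->
  (forall a : R, red a = 0 <-> exists b : R, a = w * b) ->
  (* the fixed primitive character used to define regularity *)
  primitive_char w l phi0 ->
  chi \in irr (@SL_group R n) ->
  regular_SL w l red phi0 chi ->
  (forall phis : 'I_n.-1 -> R -> algC,
      (forall i, primitive_char w l (phis i)) ->
      has_whittaker chi (theta phis))
  <-> special_regular w l red phi0 chi.
Proof.
(* The case n = 0 is excluded because p divides 0. *)
move=> p_pr p_odd pk; case: n chi => [|n] chi; first by rewrite dvdn0.
move=> _ l2 wl0 wl1 surj ker prim irr_chi reg.
have two_k : (2%:R : k) != 0.
  rewrite -(dvdn_pcharf pk) dvdn_prime2 //.
  by apply: contraTneq p_odd => ->.
split=> [H|H phis hphis].
  exact: (whittaker_special wl0 wl1 surj ker prim l2 two_k irr_chi reg H).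
exact: (special_whittaker wl0 wl1 surj ker prim l2 two_k H hphis).
Qed.
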